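(* Assume (A1)–(A4) hold and that the aggregator satisfies the robustness property (R) at every iteration. Let $$A=\frac{48BL^2c\delta}{p}+\frac{6(1-p)}{p}\Big(\frac{4c\delta}{p}+\frac{1}{2G}\Big)\Big(\omega L^2+\frac{(1+\omega)\mathcal L_\pm^2}{b}\Big)+\frac{6(1-p)}{p}\Big(\frac{4c\delta(1+\omega)}{p}+\frac{\omega}{2G}\Big)L_\pm^2,$$ and suppose $0<\gamma\le \frac{1}{L+\sqrt A}$ and $48cB\delta<p$. Then for every $K\ge 0$, if $\widehat x^K$ is chosen uniformly at random from $\{x^0,x^1,\dots,x^K\}$ (the iterates of Byz-VR-MARINA), $$\mathbb E\big[\|\nabla f(\widehat x^K)\|^2\big]\le \frac{2\,\mathbb E[\Phi_0]}{\gamma\big(1-\frac{48Bc\delta}{p}\big)(K+1)}+\frac{24c\delta\zeta^2}{p-48Bc\delta},$$ where $\Phi_0=f(x^0)-f_*+\frac{\gamma}{p}\|g^0-\nabla f(x^0)\|^2$. (In particular, for $B=0$: $\mathbb E\|\nabla f(\widehat x^K)\|^2\le \frac{2\mathbb E[\Phi_0]}{\gamma(K+1)}+\frac{24c\delta\zeta^2}{p}$.)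
   Context: Setting. There are $n$ workers indexed by $[n]=\mathcal G\sqcup\mathcal B$: $\mathcal G$ is the set of good workers, $G=|\mathcal G|\ge2$, and $\mathcal B$ is the set of Byzantine workers with $|\mathcal B|\le\delta n$, $0\le\delta<1/2$. For $i\in\mathcal G$, $f_i(x)=\frac1m\sum_{j=1}^m f_{i,j}(x)$ with differentiable $f_{i,j}:\mathbb R^d\to\mathbb R$, and $f=\frac1G\sum_{i\in\mathcal G}f_i$. All expectations $\mathbb E$ are full expectations. (A1) $f$ is $L$-smooth ($\|\nabla f(x)-\nabla f(y)\|\le L\|x-y\|$ for all $x,y$) and $f_*=\inf_x f(x)>-\infty$. (A2) ($(B,\zeta^2)$-heterogeneity) For some $B,\zeta\ge0$: $\frac1G\sum_{i\in\mathcal G}\|\nabla f_i(x)-\nabla f(x)\|^2\le B\|\nabla f(x)\|^2+\zeta^2$ for all $x$. (A3) (global Hessian variance) For some $L_\pm\ge0$: $\frac1G\sum_{i\in\mathcal G}\|\nabla f_i(x)-\nabla f_i(y)\|^2-\|\nabla f(x)-\nabla f(y)\|^2\le L_\pm^2\|x-y\|^2$ for all $x,y$. (A4) (local Hessian variance) There is a batch size $b\ge1$ and, for each $i\in\mathcal G$ and $x,y$, a random vector $\widehat\Delta_i(x,y)$ with $\mathbb E[\widehat\Delta_i(x,y)]=\Delta_i(x,y):=\nabla f_i(x)-\nabla f_i(y)$ and $\frac1G\sum_{i\in\mathcal G}\mathbb E\|\widehat\Delta_i(x,y)-\Delta_i(x,y)\|^2\le\frac{\mathcal L_\pm^2}{b}\|x-y\|^2$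 for some $\mathcal L_\pm\ge0$. Compressor: $\mathcal Q:\mathbb R^d\to\mathbb R^d$ is a stochastic map with $\mathbb E[\mathcal Q(x)]=x$ and $\mathbb E\|\mathcal Q(x)-x\|^2\le\omega\|x\|^2$ for all $x$, for some $\omega\ge0$. Algorithm Byz-VR-MARINA with stepsize $\gamma>0$, probability $p\in(0,1]$, start $x^0$, and initial vector $g^0\in\mathbb R^d$ (possibly random). For $k=0,1,2,\dots$: draw $c_k\sim\mathrm{Bernoulli}(p)$ independently of everything else; set $x^{k+1}=x^k-\gamma g^k$; each good worker $i\in\mathcal G$ sets $g_i^{k+1}=\nabla f_i(x^{k+1})$ if $c_k=1$ and $g_i^{k+1}=g^k+\mathcal Q(\widehat\Delta_i(x^{k+1},x^k))$ if $c_k=0$, where, conditionally on the past and on $c_k$, the estimators $\widehat\Delta_i$ and the compressions are sampled freshly and independently across $i\in\mathcal G$ (the compression being applied with fresh randomness to its input); each Byzantine worker $i\in\mathcal B$ sends an arbitrary vector $g_i^{k+1}$ (which may depend on everything); finally $g^{k+1}=\mathrm{ARAgg}(g_1^{k+1},\dots,g_n^{k+1})$. Robustness property (R) of the aggregator, with constant $c>0$: for every $k\ge0$, $\mathbb E\|g^{k+1}-\bar g^{k+1}\|^2\le\frac{c\delta}{G(G-1)}\sum_{i,l\in\mathcal G}\mathbb E\|g_i^{k+1}-g_l^{k+1}\|^2$, where $\bar g^{k+1}=\frac1G\sum_{i\in\mathcal G}g_i^{k+1}$. *)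

(* Defs.v *)
From HB Require Import structures.
From mathcomp Require Import all_boot all_order all_algebra.
From mathcomp Require Import all_classical all_reals all_analysis.
Set Implicit Arguments.
Unset Strict Implicit.
Unset Printing Implicit Defensive.
Import Order.TTheory GRing.Theory Num.Theory.
Import numFieldNormedType.Exports.
Local Open Scope classical_set_scope.
Local Open Scope ring_scope.

(* Borel sigma-algebra on R^d = 'rV[R]_d : generated by the coordinate maps. *)
Definition rV_display : measure_display := default_measure_display.

Section rV_measurable.
Context (R : realType) (d : nat).
Let coord : 'I_d -> 'rV[R]_d -> R := fun j v => v 0 j.
Let rV_set0 : g_sigma_preimage coord set0.
Proof. exact: sigma_algebra0. Qed.
Let rV_setC A : g_sigma_preimage coord A -> g_sigma_preimage coord (~` A).
Proof. exact: sigma_algebraC. Qed.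
Let rV_bigcup (F : _^nat) : (forall i, g_sigma_preimage coord (F i)) ->
  g_sigma_preimage coord (\bigcup_i (F i)).
Proof. exact: sigma_algebra_bigcup. Qed.
HB.instance Definition _ := @isMeasurable.Build rV_display
  ('rV[R]_d) (g_sigma_preimage coord) rV_set0 rV_setC rV_bigcup.
End rV_measurable.

Section defs.
Context {R : realType} {d : nat}.
Local Notation Rd := 'rV[R]_d.

Definition sqn (v : Rd) : R := \sum_(j < d) (v 0 j) ^+ 2.
Definition enorm (v : Rd) : R := Num.sqrt (sqn v).

Definition grad (f : Rd -> R) (x : Rd) : Rd :=
  \row_(j < d) derive f x (delta_mx 0 j).

Definition Fmeas {dO} {Omega : measurableType dO} {dT} {T : measurableType dT}
  (F : set (set Omega)) (X : Omega -> T) : Prop :=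
  forall B : set T, measurable B -> F (X @^-1` B).

Definition sub_sigma {dO} {Omega : measurableType dO} (F : set (set Omega)) :=
  sigma_algebra setT F /\ F `<=` measurable.

Definition loc_f {n m : nat} (fij : 'I_n -> 'I_m -> Rd -> R) (i : 'I_n) (x : Rd) : R :=
  m%:R^-1 * \sum_(j < m) fij i j x.
Definition glob_f {n m : nat} (Gs : {set 'I_n}) (fij : 'I_n -> 'I_m -> Rd -> R) (x : Rd) : R :=
  (#|Gs|%:R)^-1 * \sum_(i in Gs) loc_f fij i x.
End defs.

(* Byz-VR-MARINA.  Randomness: c k (coin of round k), xi k i (seed of the
   estimator of worker i at round k), eta k i (seed of the compressor of
   worker i at round k); Byzantine messages gB k i (message g_i^k, k>=1).
   state k w = (x^k, g^k).  msg k i w = g_i^{k+1}. *)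
Section marina.
Context {R : realType} {d n : nat} {dO : measure_display} {Omega : measurableType dO}
  {S SQ : Type}.
Local Notation Rd := 'rV[R]_d.
Variables (Gs : {set 'I_n}) (gradfi : 'I_n -> Rd -> Rd)
  (Dhat : 'I_n -> Rd -> Rd -> S -> Rd) (Q : Rd -> SQ -> Rd)
  (agg : n.-tuple Rd -> Rd) (gamma : R) (x0 : Rd) (g0 : Omega -> Rd)
  (c : nat -> Omega -> bool) (xi : nat -> 'I_n -> Omega -> S)
  (eta : nat -> 'I_n -> Omega -> SQ) (gB : nat -> 'I_n -> Omega -> Rd).

Definition worker_msg (k : nat) (i : 'I_n) (w : Omega) (xk gk xk1 : Rd) : Rd :=
  if i \in Gs then
    (if c k w then gradfi i xk1
     else gk + Q (Dhat i xk1 xk (xi k i w)) (eta k i w))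
  else gB k.+1 i w.

Fixpoint state (k : nat) (w : Omega) : Rd * Rd :=
  match k with
  | 0 => (x0, g0 w)
  | k'.+1 =>
      let xk := (state k' w).1 in
      let gk := (state k' w).2 in
      let xk1 := xk - gamma *: gk in
      (xk1, agg [tuple worker_msg k' i w xk gk xk1 | i < n])
  end.

Definition iter_x k w := (state k w).1.
Definition iter_g k w := (state k w).2.
Definition msg k i w :=
  worker_msg k i w (iter_x k w) (iter_g k w) (iter_x k.+1 w).
End marina.

(* Main.v *)
(* Let V = omega (L^2 + Lpm^2) + (1 + omega) Lcal^2 / b, e_k = E|g^k - grad f(x^k)|^2
   and D_k = E|x^(k+1) - x^k|^2. Given the past and c_k = 0, the messages of the good
   workers are g^k plus independent unbiased estimators of the gradient differences, so
     E|gbar^(k+1) - grad f(x^(k+1))|^2 <= (1 - p) (e_k + V D_k / G),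
   the cross terms vanishing. The pairwise spread of the messages is at most 2 G times
   their spread around a common reference point, which heterogeneity (if c_k = 1) and
   Hessian variance (if c_k = 0) control; property (R) turns this into a bound on
   E|g^(k+1) - gbar^(k+1)|^2. Young's inequality with parameter p/2 then gives a
   recursion for e_k whose contraction factor is 1 - p/2, exactly what makes
   E[f(x^k) - f_* + (gamma/p) |g^k - grad f(x^k)|^2] decrease along the descent lemma;
   telescoping yields the rate. *)
Require Import Defs.
From HB Require Import structures.
From mathcomp Require Import all_boot all_order all_algebra.
From mathcomp Require Import all_classical all_reals all_analysis.
From mathcomp Require Import measurable_realfun ring lra.
Set Implicit Arguments.
Unset Strict Implicit.
Unset Printing Implicit Defensive.
Import Order.TTheory GRing.Theory Num.Theory.
Import numFieldNormedType.Exports.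
Local Open Scope classical_set_scope.
Local Open Scope ring_scope.

(** * Euclidean space and smooth functions *)

(** No conditional expectation is formed. The joint law of (past, coin) and a fresh seed is a
    product, so conditional means and variances become inner integrals in Fubini, and a cross term
    vanishes because its inner integral does. Seeds are moved into the past one at a time, which
    also handles the compressor, whose input is already random. The coin is carried as a 0/1 factor
    on each error, so both kinds of round share one decomposition. The aggregation error may be
    correlated with everything, hence Young instead of orthogonality. Its weight 1 + 2/p <= 3/p,
    with the factor 1/p of the Lyapunov function, produces the 1/p^2 terms of [A]. Heterogeneity is
    met at x^(k+1), not at x^k. Passing back costs 2 |grad f(x^k)|^2 + 2 L^2 |x^(k+1) - x^k|^2, the
    origin of 48 B L^2 c delta / p and of the condition 48 c B delta < p, with 48 = 2 * 3 * 4 * 2.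
    Square-integrability of the iterates has to be proved: it propagates by induction when E[Phi_0]
    is finite, and otherwise the claimed bound is infinite. *)

Definition dot {R : realType} {d : nat} (u v : 'rV[R]_d) : R :=
  \sum_(j < d) u 0 j * v 0 j.

Section euclidean.
Context {R : realType} {d : nat}.
Implicit Types (u v w : 'rV[R]_d) (a : R).

Lemma sqnE u : sqn u = dot u u.
Proof. by apply: eq_bigr => j _; rewrite expr2. Qed.

Lemma dotC u v : dot u v = dot v u.
Proof. by apply: eq_bigr => j _; rewrite mulrC. Qed.

Lemma dotDl u v w : dot (u + v) w = dot u w + dot v w.
Proof. by rewrite -big_split; apply: eq_bigr => j _; rewrite mxE mulrDl. Qed.

Lemma dotDr u v w : dot w (u + v) = dot w u + dot w v.
Proof. by rewrite dotC dotDl !(dotC w). Qed.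

Lemma dotZl a u w : dot (a *: u) w = a * dot u w.
Proof. by rewrite mulr_sumr; apply: eq_bigr => j _; rewrite mxE mulrA. Qed.

Lemma dotZr a u w : dot w (a *: u) = a * dot w u.
Proof. by rewrite dotC dotZl dotC. Qed.

Lemma dotNl u w : dot (- u) w = - dot u w.
Proof. by rewrite -scaleN1r dotZl mulN1r. Qed.

Lemma dotNr u w : dot w (- u) = - dot w u.
Proof. by rewrite dotC dotNl dotC. Qed.

Lemma dot0l w : dot 0 w = 0.
Proof. by rewrite -(scale0r w) dotZl mul0r. Qed.

Lemma dot_suml (I : Type) (r : seq I) (Q : pred I) (F : I -> 'rV[R]_d) w :
  dot (\sum_(i <- r | Q i) F i) w = \sum_(i <- r | Q i) dot (F i) w.
Proof.
by elim/big_rec2 : _ => [|i y x _ <-]; rewrite ?dot0l ?dotDl.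
Qed.

Lemma sqn_ge0 u : 0 <= sqn u.
Proof. by apply: sumr_ge0 => j _; rewrite sqr_ge0. Qed.

Lemma sqnD u v : sqn (u + v) = sqn u + sqn v + 2 * dot u v.
Proof.
rewrite !sqnE dotDl !dotDr (dotC v u); ring.
Qed.

Lemma sqnZ a u : sqn (a *: u) = a ^+ 2 * sqn u.
Proof. by rewrite !sqnE dotZl dotZr mulrA expr2. Qed.

Lemma sqnN u : sqn (- u) = sqn u.
Proof. by rewrite -scaleN1r sqnZ sqrrN expr1n mul1r. Qed.

Lemma sqn0 : sqn (0 : 'rV[R]_d) = 0.
Proof. by rewrite sqnE dot0l. Qed.

Lemma sqnB u v : sqn (u - v) = sqn u + sqn v - 2 * dot u v.
Proof. by rewrite sqnD sqnN dotNr mulrN. Qed.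

Lemma young_dot u v a : 0 < a -> 2 * dot u v <= a * sqn u + a^-1 * sqn v.
Proof.
move=> a0; have := sqn_ge0 (a *: u - v).
rewrite sqnB sqnZ dotZl => h.
have : 0 <= a^-1 * (a ^+ 2 * sqn u + sqn v - 2 * (a * dot u v)).
  by rewrite mulr_ge0// invr_ge0 ltW.
have -> : a^-1 * (a ^+ 2 * sqn u + sqn v - 2 * (a * dot u v)) =
  a * sqn u + a^-1 * sqn v - 2 * dot u v by field; rewrite gt_eqF.
by rewrite subr_ge0.
Qed.

Lemma sqnD_young u v a : 0 < a ->
  sqn (u + v) <= (1 + a) * sqn u + (1 + a^-1) * sqn v.
Proof. by move=> a0; rewrite sqnD; have := young_dot u v a0; lra. Qed.

Lemma sqnD_le2 u v : sqn (u + v) <= 2 * sqn u + 2 * sqn v.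
Proof. by have := sqnD_young u v (@ltr01 R); rewrite invr1; lra. Qed.

Lemma dot_le_abs u v : `|dot u v| <= sqn u + sqn v.
Proof.
have h1 := young_dot u v (@ltr01 R); have h2 := young_dot (- u) v (@ltr01 R).
rewrite sqnN dotNl invr1 in h2; rewrite invr1 in h1.
have := sqn_ge0 u; have := sqn_ge0 v.
by rewrite ler_norml => ? ?; lra.
Qed.

End euclidean.

(** * Borel measurability of vector-valued maps *)

Section rV_measurability.
Context {R : realType} {d : nat}.
Local Notation Rd := 'rV[R]_d.

Lemma measurable_rVP dT (T : measurableType dT) (h : T -> Rd) :
  measurable_fun setT h <-> forall j, measurable_fun setT (fun t => h t 0 j).
Proof.
split=> [mh j|mh].
  move=> _ Y mY; rewrite setTI.
  have mj : measurable [set v : Rd | Y (v 0 j)].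
    apply: sub_sigma_algebra.
    rewrite -bigcup_seq/=; exists j => /=; first by rewrite mem_index_enum.
    by exists Y => //; rewrite setTI.
  by have := mh measurableT _ mj; rewrite setTI.
suff : preimage_set_system setT h (@measurable _ Rd) `<=` measurable.
  by move=> hs _ Y mY; apply: hs; exists Y.
(* Pulling a generated sigma-algebra back along [h] gives the one generated by the composites, so
   only the coordinates of [h] have to be checked. *)
have -> : preimage_set_system setT h (@measurable _ Rd) =
    g_sigma_preimage (fun (j : 'I_d) => (fun v : Rd => v 0 j) \o h).
  by rewrite g_sigma_preimage_comp.
apply: smallest_sub; first exact: sigma_algebra_measurable.
rewrite -bigcup_seq/=; apply: bigcup_sub => j _ _ [B mB <-].
exact: mh.
Qed.

Lemma measurable_coord j : measurable_fun setT (fun v : Rd => v 0 j).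
Proof. by have /measurable_rVP := @measurable_id _ Rd setT; exact. Qed.

Section ops.
Context dT (T : measurableType dT).
Implicit Types (h g : T -> Rd).

Lemma measurable_rVD h g : measurable_fun setT h -> measurable_fun setT g ->
  measurable_fun setT (fun t => h t + g t).
Proof.
move=> /measurable_rVP mh /measurable_rVP mg; apply/measurable_rVP => j.
under eq_fun do rewrite mxE; exact: measurable_funD.
Qed.

Lemma measurable_rVZ (a : T -> R) h : measurable_fun setT a ->
  measurable_fun setT h -> measurable_fun setT (fun t => a t *: h t).
Proof.
move=> ma /measurable_rVP mh; apply/measurable_rVP => j.
under eq_fun do rewrite mxE; exact: measurable_funM.
Qed.

Lemma measurable_rVN h : measurable_fun setT h ->
  measurable_fun setT (fun t => - h t).
Proof.
move=> mh; under eq_fun do rewrite -scaleN1r.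
exact: measurable_rVZ.
Qed.

Lemma measurable_rVB h g : measurable_fun setT h -> measurable_fun setT g ->
  measurable_fun setT (fun t => h t - g t).
Proof. by move=> mh mg; apply: measurable_rVD => //; exact: measurable_rVN. Qed.

Lemma measurable_rV_sum (I : Type) (r : seq I) (Q : pred I) (F : I -> T -> Rd) :
  (forall i, Q i -> measurable_fun setT (F i)) ->
  measurable_fun setT (fun t => \sum_(i <- r | Q i) F i t).
Proof.
move=> mF; elim: r => [|i r ih].
  by under eq_fun do rewrite big_nil; exact: measurable_cst.
have [Qi|nQi] := boolP (Q i).
  under eq_fun do rewrite big_cons Qi; exact: measurable_rVD (mF _ Qi) ih.
by under eq_fun do rewrite big_cons (negbTE nQi).
Qed.

Lemma measurable_dot h g : measurable_fun setT h -> measurable_fun setT g ->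
  measurable_fun setT (fun t => dot (h t) (g t)).
Proof.
move=> /measurable_rVP mh /measurable_rVP mg; apply: measurable_sum => j.
exact: measurable_funM.
Qed.

Lemma measurable_sqn h : measurable_fun setT h ->
  measurable_fun setT (fun t => sqn (h t)).
Proof. by move=> mh; under eq_fun do rewrite sqnE; exact: measurable_dot. Qed.

End ops.

(* Grid points [floor ((k+1) x) / (k+1)] form a countable set, so [h] is a
   pointwise limit of functions that are constant on countably many boxes. *)
Lemma continuous_measurable_rV (h : Rd -> R) :
  (forall (x : Rd) (e : R), 0 < e -> exists2 r : R, 0 < r &
    forall y : Rd, (forall j, `|y 0 j - x 0 j| < r) -> `|h y - h x| < e) ->
  measurable_fun setT h.
Proof.
move=> hc.
pose zc (k : nat) (x : Rd) : 'rV[int]_d := \row_j Num.floor (x 0 j * k.+1%:R).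
pose pt (k : nat) (z : 'rV[int]_d) : Rd := \row_j ((z 0 j)%:~R / k.+1%:R).
apply: (@measurable_fun_cvg _ _ _ _ (fun k x => h (pt k (zc k x)))) => [k|x _].
  move=> _ Y mY; rewrite setTI.
  have -> : (fun x => h (pt k (zc k x))) @^-1` Y = \bigcup_z
      (if `[< Y (h (pt k z)) >] then
        \bigcap_(j in [set: 'I_d]) [set x : Rd | zc k x 0 j = z 0 j] else set0).
    apply/seteqP; split=> x /=.
      move=> Yx; exists (zc k x) => //=.
      by case: asboolP => //= _ j _.
    move=> [z _]; case: asboolP => //= Yz xz.
    suff -> : zc k x = z by [].
    by apply/rowP => j; exact: xz.
  apply: countable_bigcupT_measurable; first exact: countableP.
  move=> z; case: asboolP => // _.
  apply: fin_bigcap_measurable => // j _.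
  have -> : [set x : Rd | zc k x 0 j = z 0 j] =
     setT `&` (fun x : Rd => x 0 j * k.+1%:R) @^-1` (`[(z 0 j)%:~R, (z 0 j + 1)%:~R[).
    rewrite setTI; apply/seteqP; split=> x /=; rewrite mxE in_itv/=.
      move=> <-; by rewrite floor_le/= floorD1_gt.
    by move=> /andP[a b]; apply/floor_def; rewrite a b.
  have mj : measurable_fun setT (fun x : Rd => x 0 j * k.+1%:R).
    by apply: measurable_funM => //; exact: measurable_coord.
  exact: mj.
apply/cvgrPdist_lt => e e0.
have [r r0 hr] := hc x e e0.
have [N _ hN] : \forall k \near \oo, k.+1%:R^-1 < r.
  by exact: (near_infty_natSinv_lt (PosNum r0)).
near=> k.
rewrite distrC; apply: hr => j.
apply: le_lt_trans (hN k _); last by near: k; exists N.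
rewrite !mxE.
set a := x 0 j; have k0 : (0 : R) < k.+1%:R by [].
have f1 : (Num.floor (a * k.+1%:R))%:~R <= a * k.+1%:R by apply: floor_le.
have f2 : a * k.+1%:R < (Num.floor (a * k.+1%:R) + 1)%:~R by exact: floorD1_gt.
rewrite intrD in f2.
rewrite ler_norml; apply/andP; split.
  rewrite lerBrDr -(@ler_pM2r _ k.+1%:R)// mulfVK ?gt_eqF// mulrDl mulNr mulVf ?gt_eqF//.
  lra.
rewrite lerBlDr -(@ler_pM2r _ k.+1%:R)// mulfVK ?gt_eqF// mulrDl mulVf ?gt_eqF//.
lra.
Unshelve. all: end_near. Qed.

End rV_measurability.

(** The local gradients are known only through Lipschitz-type bounds on squared norms, and this is
    how they become measurable. *)
Lemma lipschitz_measurable_rV (R : realType) (d dn : nat)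
  (h : 'rV[R]_d -> 'rV[R]_dn) (C : R) :
  (forall x y, sqn (h x - h y) <= C * sqn (x - y)) -> measurable_fun setT h.
Proof.
move=> hC; apply/measurable_rVP => i; apply: continuous_measurable_rV => x e e0.
(* Coordinates within e / M give a squared distance of at most d (e / M)^2, and |C| d = M - 1 <
   M^2. *)
pose M := 1 + `|C| * d%:R.
have M0 : 0 < M by rewrite /M ltr_wpDr// mulr_ge0.
exists (e / M) => [|y hy]; first by rewrite divr_gt0.
have cy : sqn (y - x) <= d%:R * (e / M) ^+ 2.
  rewrite /sqn mulr_natl -[X in _ *+ X]card_ord -sumr_const.
  apply: ler_sum => j _; rewrite !mxE -real_normK ?num_real//.
  by rewrite lerXn2r// ?nnegrE// ?ltW// ?divr_gt0.
have ch : (h y 0 i - h x 0 i) ^+ 2 <= sqn (h y - h x).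
  rewrite /sqn (bigD1 i)//= !mxE lerDl; apply: sumr_ge0 => *; exact: sqr_ge0.
have c2 : sqn (h y - h x) < e ^+ 2.
  apply: le_lt_trans (hC _ _) _.
  apply: (@le_lt_trans _ _ (`|C| * (d%:R * (e / M) ^+ 2))).
    apply: (@le_trans _ _ (`|C| * sqn (y - x))).
      by rewrite ler_wpM2r ?sqn_ge0// ler_norm.
    by rewrite ler_wpM2l.
  have -> : `|C| * (d%:R * (e / M) ^+ 2) = e ^+ 2 * ((M - 1) / M ^+ 2).
    by rewrite /M; field; rewrite gt_eqF.
  rewrite -[ltRHS]mulr1 ltr_pM2l ?exprn_gt0//.
  rewrite ltr_pdivrMr ?exprn_gt0// mul1r.
  have : 0 <= M - 1 by rewrite /M addrC addKr mulr_ge0.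
  nra.
have := le_lt_trans ch c2.
by rewrite -real_normK ?num_real// ltr_pXn2r// ?nnegrE ltW.
Qed.

(** * Gradients and the descent inequality *)

Section gradient.
Context {R : realType} {d : nat}.
Local Notation Rd := 'rV[R]_d.
Implicit Types (f : Rd -> R) (x v : Rd).

Lemma derive_dot f x v : differentiable f x -> 'D_v f x = dot (grad f x) v.
Proof.
move=> df; rewrite deriveE// {1}(row_sum_delta v) linear_sum/=.
apply: eq_bigr => j _; rewrite linearZ/= mxE deriveE//.
by rewrite mulrC.
Qed.

Lemma differentiable_measurable f : (forall x, differentiable f x) ->
  measurable_fun setT f.
Proof.
move=> df; apply: continuous_measurable_rV => x e e0.
have /differentiable_continuous/cvgrPdist_lt/(_ e e0) := df x.
move=> /nbhs_ballP[r /= r0 hr]; exists r => // y hy.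
rewrite distrC; apply: hr; split => // i j.
by rewrite ord1 /ball/= distrC.
Qed.

Lemma is_derive_line f x v (t : R) : differentiable f (x + t *: v) ->
  is_derive t (1 : R) (fun s : R => f (x + s *: v)) (dot (grad f (x + t *: v)) v).
Proof.
move=> df; rewrite -derive_dot//.
have dl : is_diff t (fun s : R => x + s *: v) (fun s : R => s *: v).
  have := @is_diffD R R Rd (cst x) (fun s : R => s *: v) 0 (fun s => s *: v) t _ _.
  by rewrite add0r; apply; exact: is_diff_scalel.
have dc : differentiable (f \o (fun s : R => x + s *: v)) t.
  exact: differentiable_comp.
apply: DeriveDef; first exact: diff_derivable.
by rewrite deriveE// diff_comp//= diff_val/= scale1r deriveE.
Qed.

Lemma enorm_ge0 v : 0 <= enorm v. Proof. exact: sqrtr_ge0. Qed.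

Lemma enorm_sqr v : enorm v ^+ 2 = sqn v.
Proof. by rewrite sqr_sqrtr// sqn_ge0. Qed.

Lemma sqn_eq0 v : sqn v = 0 -> v = 0.
Proof.
move=> v0; apply/rowP => j; rewrite mxE; apply/eqP; rewrite -sqrf_eq0; apply/eqP.
by apply: (psumr_eq0P _ v0) => // i _; exact: sqr_ge0.
Qed.

(** A substitute for Cauchy-Schwarz: Young with weight 1/C gives 2 <u,v> <= |u|^2 / C + C |v|^2 <= 2
    C |v|^2. For C <= 0 the hypothesis forces u = 0. *)
Lemma dot_le_enorm (u v : Rd) (C : R) :
  enorm u <= C * enorm v -> dot u v <= C * sqn v.
Proof.
move=> uv; have u0 := enorm_ge0 u; have v0 := enorm_ge0 v.
have [C0|C0] := leP C 0.
  have : enorm u = 0 by nra.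
  move=> eu; have -> : u = 0 by apply: sqn_eq0; rewrite -enorm_sqr eu expr0n.
  by rewrite dot0l -enorm_sqr; nra.
have := @young_dot R d u v C^-1; rewrite invr_gt0 invrK => /(_ C0) h.
have h2 : sqn u <= C ^+ 2 * sqn v.
  rewrite -!enorm_sqr -exprMn lerXn2r// ?nnegrE//.
  by rewrite mulr_ge0// ltW.
have h3 : C^-1 * sqn u <= C * sqn v.
  by rewrite mulrC ler_pdivrMr// mulrAC -expr2.
lra.
Qed.

Lemma sqn_le_enorm (u v : Rd) (C : R) :
  enorm u <= C * enorm v -> sqn u <= C ^+ 2 * sqn v.
Proof.
move=> uv; rewrite -!enorm_sqr -exprMn lerXn2r// ?nnegrE ?enorm_ge0//.
by rewrite (le_trans _ uv)// enorm_ge0.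
Qed.

Lemma smooth_descent f (L : R) x v : (forall y, differentiable f y) ->
  (forall y z, enorm (grad f y - grad f z) <= L * enorm (y - z)) ->
  f (x + v) <= f x + dot (grad f x) v + L / 2 * sqn v.
Proof.
move=> df Lf.
(* Once the quadratic upper model along the segment is subtracted, smoothness makes the derivative
   nonpositive on (0,1), so the mean value theorem replaces an integral of the gradient. *)
pose phi (t : R) := f (x + t *: v) - (t * dot (grad f x) v + t ^+ 2 * (L / 2 * sqn v)).
pose dphi (t : R) := dot (grad f (x + t *: v)) v - (dot (grad f x) v + t * (L * sqn v)).
have hd (t : R) : is_derive t (1 : R) phi (dphi t).
  have h1 := @is_derive_line f x v t (df _).
  have h2 : is_derive t (1 : R) (fun s : R =>
      s * dot (grad f x) v + s ^+ 2 * (L / 2 * sqn v))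
      (dot (grad f x) v + t * (L * sqn v)).
    by apply: is_derive_eq; rewrite /GRing.scale/= !mulr0 !mulr1; field.
  have h3 := is_deriveB h1 h2; exact: h3.
have cphi : {within `[0, 1], continuous phi}.
  apply: continuous_subspaceT => t; apply: differentiable_continuous.
  by apply/derivable1_diffP; have [] := hd t.
have [t] := @MVT R phi dphi 0 1 ltr01 (fun t _ => hd t) cphi.
rewrite in_itv/= => /andP[t0 t1]; rewrite subr0 mulr1 /phi scale1r scale0r addr0.
rewrite expr1n expr0n/= !mul0r !mul1r => h.
have : dphi t <= 0.
  rewrite /dphi opprD addrA -dotNl -dotDl subr_le0.
  rewrite mulrCA mulrA; apply: dot_le_enorm; apply: le_trans (Lf _ _) _.
  rewrite addrAC subrr add0r /enorm sqnZ sqrtrM ?sqr_ge0// sqrtr_sqr.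
  by rewrite ger0_norm ?(ltW t0)// mulrA.
lra.
Qed.

End gradient.

Section finite_sum.
Context {R : realType} {d n m : nat}.
Variables (Gs : {set 'I_n}) (fij : 'I_n -> 'I_m -> 'rV[R]_d -> R).
Hypothesis dfij : forall i j x, i \in Gs -> differentiable (fij i j) x.

Lemma differentiable_loc_f i x : i \in Gs -> differentiable (loc_f fij i) x.
Proof.
move=> iG.
have -> : loc_f fij i = m%:R^-1 \*: (\sum_(j < m) fij i j).
  by apply/funext => y; rewrite /loc_f/= fct_sumE.
by apply: differentiableZ; apply: differentiable_sum => j; exact: dfij.
Qed.

(** Differentiability is known for good workers only; the default 0 makes every summand
    differentiable, so the sum can run over all indices. *)
Let fG (i : 'I_n) : 'rV[R]_d -> R := if i \in Gs then loc_f fij i else cst 0.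

Let glob_fE : glob_f Gs fij = #|Gs|%:R^-1 \*: (\sum_(i < n) fG i).
Proof.
apply/funext => y; rewrite /glob_f/= fct_sumE big_mkcond/=.
by congr (_ * _); apply: eq_bigr => i _; rewrite /fG; case: ifP.
Qed.

Let differentiable_fG i x : differentiable (fG i) x.
Proof. by rewrite /fG; case: ifPn => // iG; exact: differentiable_loc_f. Qed.

Lemma differentiable_glob_f x : differentiable (glob_f Gs fij) x.
Proof.
by rewrite glob_fE; apply: differentiableZ; apply: differentiable_sum.
Qed.

Lemma grad_glob_f x : grad (glob_f Gs fij) x =
  #|Gs|%:R^-1 *: \sum_(i in Gs) grad (loc_f fij i) x.
Proof.
apply/rowP => j; rewrite !mxE summxE glob_fE deriveZ; last first.
  by apply: diff_derivable; apply: differentiable_sum.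
rewrite derive_sum => [|i]; last exact: diff_derivable.
rewrite [in RHS]big_mkcond/=; congr (_ * _); apply: eq_bigr => i _.
by rewrite /fG; case: ifPn => iG; rewrite ?mxE// derive_cst.
Qed.

End finite_sum.

(** * Independence and square-integrable vectors *)

Section independence.
Context {R : realType} {dO : measure_display} {Omega : measurableType dO}.
Variable P : probability Omega R.
Local Open Scope ereal_scope.

Definition indep_event {dT} {T : measurableType dT} (V : Omega -> T)
  (E : set Omega) (q : \bar R) : Prop :=
  forall A : set T, measurable A -> P (V @^-1` A `&` E) = P (V @^-1` A) * q.

(** Independence and the law of [Z] in one condition: [A = setT] forces [rho] to be that law. *)
Definition indep_law {d1 d2} {T1 : measurableType d1} {T2 : measurableType d2}
  (V : Omega -> T1) (Z : Omega -> T2) (rho : probability T2 R) : Prop :=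
  forall B : set T2, measurable B -> indep_event V (Z @^-1` B) (rho B).

Section pair.
Context {d1 d2} {T1 : measurableType d1} {T2 : measurableType d2}.
Variables (V : Omega -> T1) (Z : Omega -> T2).
Hypotheses (mV : measurable_fun setT V) (mZ : measurable_fun setT Z).

Let V' : {mfun Omega >-> T1} := HB.pack V (isMeasurableFun.Build _ _ _ _ _ mV).
Let VZ : Omega -> T1 * T2 := fun w => (V w, Z w).
Let mVZ : measurable_fun setT VZ. Proof. exact: measurable_fun_pair. Qed.

(** As functions of the set of pairs, both sides are measures: the image under (V, Z) of [P]
    restricted to [E], which is finite, and of [P] scaled by [q]. They agree on rectangles, a
    pi-system, hence everywhere. *)
Lemma indep_event_pair (E : set Omega) (q : \bar R) : measurable E ->
  q \is a fin_num -> 0 <= q ->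
  (forall A B, measurable A -> measurable B ->
    P (V @^-1` A `&` Z @^-1` B `&` E) = P (V @^-1` A `&` Z @^-1` B) * q) ->
  indep_event (fun w => (V w, Z w)) E q.
Proof.
move=> mE; case: q => // q _; rewrite lee_fin => q0 hq C mC.
pose m1' : {measure set (T1 * T2) -> \bar R} := pushforward (mrestr P mE) VZ.
pose m2' : {measure set (T1 * T2) -> \bar R} :=
  mscale (NngNum q0) (pushforward P VZ).
pose m1 := m1' mVZ; pose m2 := m2' mVZ.
have m1E A : m1 A = P (VZ @^-1` A `&` E) by [].
have m2E A : m2 A = q%:E * P (VZ @^-1` A) by [].
rewrite muleC -m1E -m2E.
apply: (@measure_unique _ R _ [set A `*` B | A in measurable & B in measurable]
  (fun=> setT)) => //.
- exact: measurable_prod_measurableType.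
- move=> _ _ [A mA [B mB <-]] [A' mA' [B' mB' <-]].
  exists (A `&` A'); first exact: measurableI.
  by exists (B `&` B'); [exact: measurableI|rewrite setXI].
- by move=> _; exists setT => //; exists setT => //; rewrite setXTT.
- by rewrite bigcup_const//; exists 0%N.
- move=> _ [A mA [B mB <-]]; by rewrite m1E m2E muleC -hq.
- move=> _; rewrite m1E.
  apply: le_lt_trans (_ : P setT < +oo); last by rewrite probability_setT ltry.
  apply: le_measure; rewrite ?inE//; apply: measurableI => //.
  by rewrite -[X in measurable X]setTI; exact: mVZ.
Qed.

Section integral.
Variable rho : probability T2 R.
Hypothesis VZi : indep_law V Z rho.
Variable h : T1 * T2 -> \bar R.
Hypothesis mh : measurable_fun setT h.

Let PV : probability T1 R := distribution P V'.

Let joint A : measurable A -> (PV \x rho) A = pushforward P VZ A.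
Proof.
by move=> mA; apply: product_measure_unique => //= B C mB mC; rewrite -VZi.
Qed.

Lemma ge0_indep_law_integral : (forall z, 0 <= h z) ->
  \int[P]_w h (V w, Z w) = \int[P]_w \int[rho]_z h (V w, z).
Proof.
move=> h0.
transitivity (\int[pushforward P VZ]_z h z).
  by rewrite ge0_integral_pushforward.
rewrite -(@eq_measure_integral _ _ _ _ _ (PV \x rho)%E); last first.
  by move=> A mA _; exact: joint.
rewrite fubini_tonelli1// /PV /distribution ge0_integral_pushforward//.
  exact: measurable_fun_fubini_tonelli_F.
by move=> y _; apply: integral_ge0.
Qed.

(** The stand-in for zero conditional mean: Fubini integrates the fresh variable first. Signed [h]
    needs integrability here, where the nonnegative case above uses Tonelli. *)
Lemma indep_law_integral0 : P.-integrable setT (fun w => h (V w, Z w)) ->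
  (forall v, \int[rho]_z h (v, z) = 0) -> \int[P]_w h (V w, Z w) = 0.
Proof.
move=> hi h0.
have prodE f : \int[pushforward P VZ]_z f z = \int[PV \x rho]_z f z.
  rewrite -(@eq_measure_integral _ _ _ _ _ (PV \x rho)%E)// => A mA _.
  exact: joint.
have hprod : (PV \x rho)%E.-integrable setT h.
  apply/integrableP; split => //; rewrite -prodE.
  rewrite ge0_integral_pushforward//; last exact: measurableT_comp.
  by rewrite preimage_setT; have /integrableP[] := hi.
transitivity (\int[pushforward P VZ]_z h z).
  by rewrite integral_pushforward.
rewrite prodE -integral12_prod_meas1//.
under eq_integral do rewrite /fubini_F h0.
exact: integral0.
Qed.
End integral.
End pair.

(** The event [c = true] determines the rest: [c = false] follows by subtraction, and [bool] has
    four subsets. *)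
Lemma indep_law_bool {dT} {T : measurableType dT} (V : Omega -> T)
  (c : Omega -> bool) (p : R) : measurable_fun setT V -> measurable_fun setT c ->
  (0 <= p <= 1)%R -> indep_event V (c @^-1` [set true]) p%:E ->
  indep_law V c (bernoulli_prob p).
Proof.
move=> mV mc p01 Vt.
have mcB B : measurable (c @^-1` B) by rewrite -[X in measurable X]setTI; exact: mc.
have mVA A : measurable A -> measurable (V @^-1` A).
  by move=> mA; rewrite -[X in measurable X]setTI; exact: mV.
have Vf : indep_event V (c @^-1` [set false]) (1 - p)%:E.
  move=> A mA.
  have mAc B : measurable (V @^-1` A `&` c @^-1` B).
    by apply: measurableI => //; exact: mVA.
  have : P (V @^-1` A) = P (V @^-1` A `&` c @^-1` [set true]) +
      P (V @^-1` A `&` c @^-1` [set false]).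
    rewrite -measureU//; last by apply/seteqP; split => // w [[_ /= ->] [_ /=]].
    rewrite -setIUr; congr (P _); apply/seteqP; split => w /=; last by case.
    by move=> Aw; split => //; case: (c w); [left|right].
  rewrite Vt//.
  have : P (V @^-1` A `&` c @^-1` [set false]) \is a fin_num.
    exact: fin_num_measure.
  have : P (V @^-1` A) \is a fin_num by apply: fin_num_measure; exact: mVA.
  move=> /fineK <- /fineK <-; rewrite -!EFinM -EFinD => -[e]; congr EFin.
  by move: e; set a := fine _; set b := fine _ => e; rewrite mulrBr mulr1 {1}e addrC addKr.
move=> B mB A mA.
have [->|->|->|->] : [\/ B = set0, B = [set true], B = [set false] | B = setT].
- have [t|t] := pselect (B true); have [f|f] := pselect (B false).
  + by constructor 4; apply/seteqP; split => // -[].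
  + by constructor 2; apply/seteqP; split => // -[]//= ->.
  + by constructor 3; apply/seteqP; split => // -[]//= ->.
  + by constructor 1; apply/seteqP; split => // -[].
- by rewrite preimage_set0 setI0 !measure0 mule0.
- rewrite Vt//; congr (_ * _); have /= -> := bernoulli_probE p01 [set true].
  by rewrite !diracE mem_set//= memNset//= mule1 mule0 adde0.
- rewrite Vf//; congr (_ * _); have /= -> := bernoulli_probE p01 [set false].
  by rewrite !diracE memNset//= mem_set//= mule1 mule0 add0e.
- by rewrite preimage_setT setIT probability_setT mule1.
Qed.

End independence.

(** * Square-integrable random vectors *)

Section square_integrable.
Context {R : realType} {dO : measure_display} {Omega : measurableType dO}.
Variable P : probability Omega R.
Context {d : nat}.
Local Notation Rd := 'rV[R]_d.
Implicit Types (X Y : Omega -> Rd).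

Definition L2 X : Prop :=
  measurable_fun setT X /\ P.-integrable setT (EFin \o (fun w => sqn (X w))).

(** Real-valued, so that an infinite integral would be read as 0; statements about [Esq] and [Edot]
    therefore travel with [L2]. *)
Definition Esq X : R := \int[P]_w sqn (X w).
Definition Edot X Y : R := \int[P]_w dot (X w) (Y w).

Lemma integrable_EFinD (f h : Omega -> R) : P.-integrable setT (EFin \o f) ->
  P.-integrable setT (EFin \o h) ->
  P.-integrable setT (EFin \o (fun w => f w + h w)).
Proof. exact: integrableD. Qed.

Lemma integrable_EFinZ (k : R) (f : Omega -> R) : P.-integrable setT (EFin \o f) ->
  P.-integrable setT (EFin \o (fun w => k * f w)).
Proof. exact: integrableZl. Qed.

Lemma L2_le X (h : Omega -> R) : measurable_fun setT X ->
  P.-integrable setT (EFin \o h) -> (forall w, sqn (X w) <= h w) -> L2 X.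
Proof.
move=> mX hi Xh; split => //; apply: le_integrable hi => //.
  by apply/measurable_EFinP; exact: measurable_sqn.
move=> w _ /=; rewrite lee_fin ger0_norm ?sqn_ge0//.
exact: le_trans (Xh w) (ler_norm _).
Qed.

Lemma integrable_sqnZ (k : R) X : L2 X ->
  P.-integrable setT (EFin \o (fun w => k * sqn (X w))).
Proof.
by move=> [_]; exact: integrable_EFinZ.
Qed.

Lemma L2_leZ (k : R) X Y : measurable_fun setT X -> L2 Y ->
  (forall w, sqn (X w) <= k * sqn (Y w)) -> L2 X.
Proof. by move=> mX LY; apply: L2_le => //; exact: integrable_sqnZ. Qed.

Lemma L2_lty X : measurable_fun setT X ->
  (\int[P]_w (sqn (X w))%:E < +oo)%E -> L2 X.
Proof.
move=> mX Xoo; split => //; apply/integrableP; split.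
  by apply/measurable_EFinP; exact: measurable_sqn.
by under eq_integral do rewrite /= ger0_norm ?sqn_ge0//.
Qed.

Lemma L2_Esq X : L2 X -> (\int[P]_w (sqn (X w))%:E)%E = (Esq X)%:E.
Proof. by move=> [mX iX]; rewrite /Esq /Rintegral fineK// integrable_fin_num. Qed.

Lemma Esq_ge0 X : 0 <= Esq X.
Proof. by apply: Rintegral_ge0 => w _; exact: sqn_ge0. Qed.

Lemma L2D X Y : L2 X -> L2 Y -> L2 (fun w => X w + Y w).
Proof.
move=> [mX iX] [mY iY].
apply: (@L2_le _ (fun w => 2 * sqn (X w) + 2 * sqn (Y w))) => [||w].
- exact: measurable_rVD.
- by apply: integrable_EFinD; exact: integrable_EFinZ.
- exact: sqnD_le2.
Qed.

Lemma L2Z (a : R) X : L2 X -> L2 (fun w => a *: X w).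
Proof.
move=> [mX iX]; apply: (@L2_le _ (fun w => a ^+ 2 * sqn (X w))) => [||w].
- by apply: measurable_rVZ.
- exact: integrable_EFinZ.
- by rewrite sqnZ.
Qed.

Lemma L2B X Y : L2 X -> L2 Y -> L2 (fun w => X w - Y w).
Proof.
move=> LX LY; have := L2D LX (L2Z (-1) LY).
by under eq_fun do rewrite scaleN1r.
Qed.

Lemma L2_cst (v : Rd) : L2 (fun=> v).
Proof. by split => //; exact: finite_measure_integrable_cst. Qed.

Lemma L2_sum (I : Type) (r : seq I) (Q : pred I) (F : I -> Omega -> Rd) :
  (forall i, Q i -> L2 (F i)) -> L2 (fun w => \sum_(i <- r | Q i) F i w).
Proof.
move=> LF; elim: r => [|i r ih].
  by under eq_fun do rewrite big_nil; exact: L2_cst.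
have [Qi|nQi] := boolP (Q i).
  by under eq_fun do rewrite big_cons Qi; exact: L2D (LF _ Qi) ih.
by under eq_fun do rewrite big_cons (negbTE nQi).
Qed.

Lemma L2_dot X Y : L2 X -> L2 Y ->
  P.-integrable setT (EFin \o (fun w => dot (X w) (Y w))).
Proof.
move=> [mX iX] [mY iY].
apply: (@le_integrable _ _ _ P setT _ _
    ((EFin \o (fun w => sqn (X w))) \+ (EFin \o (fun w => sqn (Y w))))%E) => //.
- by apply/measurable_EFinP; exact: measurable_dot.
- move=> w _ /=; rewrite lee_fin [leRHS]ger0_norm ?addr_ge0 ?sqn_ge0//.
  exact: dot_le_abs.
- exact: integrableD.
Qed.

Lemma EsqZ (a : R) X : L2 X -> Esq (fun w => a *: X w) = a ^+ 2 * Esq X.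
Proof.
move=> [mX iX]; rewrite -RintegralZl//; apply: eq_Rintegral => w _; exact: sqnZ.
Qed.

Lemma EsqD X Y : L2 X -> L2 Y ->
  Esq (fun w => X w + Y w) = Esq X + Esq Y + 2 * Edot X Y.
Proof.
move=> LX LY; have iXY := L2_dot LX LY; have [mX iX] := LX; have [mY iY] := LY.
rewrite -RintegralZl// -RintegralD// -RintegralD//.
- by apply: eq_Rintegral => w _; exact: sqnD.
- exact: integrable_EFinD.
- exact: integrable_EFinZ.
Qed.

Lemma EdotDl X Y Z : L2 X -> L2 Y -> L2 Z ->
  Edot (fun w => X w + Y w) Z = Edot X Z + Edot Y Z.
Proof.
move=> LX LY LZ; rewrite -RintegralD//; [|exact: L2_dot..].
by apply: eq_Rintegral => w _; exact: dotDl.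
Qed.

Lemma EdotC X Y : Edot X Y = Edot Y X.
Proof. by apply: eq_Rintegral => w _; exact: dotC. Qed.

Lemma EdotZr (a : R) X Y : L2 X -> L2 Y ->
  Edot X (fun w => a *: Y w) = a * Edot X Y.
Proof.
move=> LX LY; rewrite /Edot -RintegralZl//; last exact: L2_dot.
by apply: eq_Rintegral => w _; exact: dotZr.
Qed.

Lemma Edot_suml (I : Type) (r : seq I) (Q : pred I) (F : I -> Omega -> Rd) Y :
  (forall i, Q i -> L2 (F i)) -> L2 Y ->
  Edot (fun w => \sum_(i <- r | Q i) F i w) Y = \sum_(i <- r | Q i) Edot (F i) Y.
Proof.
move=> LF LY; elim: r => [|i r ih].
  rewrite big_nil; under [LHS]eq_Rintegral do rewrite big_nil dot0l.
  by rewrite Rintegral_cst//= mul0r.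
rewrite big_cons -ih; have [Qi|nQi] := boolP (Q i).
  rewrite -EdotDl//; [|exact: LF|exact: L2_sum].
  by apply: eq_Rintegral => w _; rewrite big_cons Qi.
by apply: eq_Rintegral => w _; rewrite big_cons (negbTE nQi).
Qed.

(** Pairwise orthogonality is what lets the error of an average of G messages scale like 1/G.
    Uniqueness of [r] ensures that the index peeled off differs from all remaining ones. *)
Lemma pythagoras (I : eqType) (r : seq I) (Q : pred I) X (F : I -> Omega -> Rd) :
  uniq r -> L2 X -> (forall i, Q i -> L2 (F i)) ->
  (forall i, Q i -> Edot X (F i) = 0) ->
  (forall i l, Q i -> Q l -> i != l -> Edot (F i) (F l) = 0) ->
  Esq (fun w => X w + \sum_(i <- r | Q i) F i w) =
  Esq X + \sum_(i <- r | Q i) Esq (F i).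
Proof.
move=> ur LX LF XF FF; elim: r ur => [_|i r ih /= /andP[ir ur]].
  by rewrite big_nil addr0; apply: eq_Rintegral => w _; rewrite big_nil addr0.
rewrite big_cons; have [Qi|nQi] := boolP (Q i); last first.
  by rewrite -ih//; apply: eq_Rintegral => w _; rewrite big_cons (negbTE nQi).
have Lr := L2_sum r LF; have LXr := L2D LX Lr.
rewrite addrCA -ih// addrC.
transitivity (Esq (fun w => (X w + \sum_(j <- r | Q j) F j w) + F i w)).
  by apply: eq_Rintegral => w _; rewrite big_cons Qi addrCA addrC.
rewrite EsqD//; last exact: LF.
rewrite EdotDl//; last exact: LF.
rewrite XF// Edot_suml//; last exact: LF.
rewrite big_seq_cond big1 ?addr0 ?mulr0 ?addr0// => j /andP[jr Qj].
by apply: FF => //; apply: contraNneq ir => <-.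
Qed.

(** With [V] frozen at v, the vector [a v] is constant and the inner product integrates coordinate
    by coordinate to 0. *)
Lemma indep_law_dot0 {d1 d2} {T1 : measurableType d1} {T2 : measurableType d2}
  (V : Omega -> T1) (Z : Omega -> T2) (rho : probability T2 R)
  (a : T1 -> Rd) (h : T1 * T2 -> Rd) :
  measurable_fun setT V -> measurable_fun setT Z -> indep_law P V Z rho ->
  measurable_fun setT a -> measurable_fun setT h ->
  L2 (fun w => a (V w)) -> L2 (fun w => h (V w, Z w)) ->
  (forall v j, rho.-integrable setT (fun z => (h (v, z) 0 j)%:E) /\
     (\int[rho]_z (h (v, z) 0 j)%:E = 0)%E) ->
  Edot (fun w => a (V w)) (fun w => h (V w, Z w)) = 0.
Proof.
move=> mV mZ VZ ma mh La Lh h0.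
rewrite /Edot /Rintegral.
rewrite (@indep_law_integral0 _ _ _ P _ _ _ _ V Z mV mZ rho VZ
  (fun z => (dot (a z.1) (h z))%:E))//.
- apply/measurable_EFinP; apply: measurable_dot => //.
  exact: measurableT_comp.
- exact: L2_dot La Lh.
move=> v /=; under eq_integral do rewrite /dot -sumEFin.
rewrite integral_sum//=; last first.
  move=> j; under eq_fun do rewrite EFinM; apply: integrableZl => //.
  by have [] := h0 v j.
apply: big1 => j _; under eq_integral do rewrite EFinM.
by have [hi e] := h0 v j; rewrite integralZl// e mule0.
Qed.

End square_integrable.

(** * Fresh randomness of one round *)

Section seeds.
Context {R : realType} {n : nat} {dO : measure_display} {Omega : measurableType dO}.
Variable P : probability Omega R.
Context {dS} {S : measurableType dS} {dQ} {SQ : measurableType dQ}.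
Variables (Gs : {set 'I_n}) (nu : 'I_n -> probability S R) (nuQ : probability SQ R).
Variables (xi : 'I_n -> Omega -> S) (eta : 'I_n -> Omega -> SQ).
Hypothesis mxi : forall i, i \in Gs -> measurable_fun setT (xi i).
Hypothesis meta : forall i, i \in Gs -> measurable_fun setT (eta i).
Local Open Scope ereal_scope.

Definition seed_event (Bs : 'I_n -> set S) (Cs : 'I_n -> set SQ) : set Omega :=
  \bigcap_(i in [set i | i \in Gs]) ((xi i @^-1` Bs i) `&` (eta i @^-1` Cs i)).

Definition seed_prob (Bs : 'I_n -> set S) (Cs : 'I_n -> set SQ) : \bar R :=
  \big[*%E/1%E]_(i in Gs) (nu i (Bs i) * nuQ (Cs i)).

(* [V] is independent of all the seeds except possibly [xi i], [i \in UX], and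
   [eta i], [i \in UE]. *)
Definition fresh {dV} {T : measurableType dV} (V : Omega -> T)
  (UX UE : {set 'I_n}) : Prop :=
  forall Bs Cs, (forall i, measurable (Bs i)) -> (forall i, measurable (Cs i)) ->
  (forall i, i \in UX -> Bs i = setT) -> (forall i, i \in UE -> Cs i = setT) ->
  indep_event P V (seed_event Bs Cs) (seed_prob Bs Cs).

(** This moves [Z] from the fresh side to the past: joint freshness of [Z] and [E] factors, and what
    remains is independence of [E] from the enlarged past. *)
Lemma indep_event_extend {d1 d2} {T1 : measurableType d1} {T2 : measurableType d2}
  (V : Omega -> T1) (Z : Omega -> T2) (rho : probability T2 R) (E : set Omega) q :
  measurable_fun setT V -> measurable_fun setT Z -> measurable E ->
  q \is a fin_num -> 0 <= q -> indep_law P V Z rho ->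
  (forall B, measurable B -> indep_event P V (Z @^-1` B `&` E) (rho B * q)) ->
  indep_event P (fun w => (V w, Z w)) E q.
Proof.
move=> mV mZ mE qf q0 VZ VZE; apply: indep_event_pair => // A B mA mB.
by rewrite -setIA VZE// VZ// muleA.
Qed.

Lemma measurable_seed_event Bs Cs : (forall i, measurable (Bs i)) ->
  (forall i, measurable (Cs i)) -> measurable (seed_event Bs Cs).
Proof.
move=> mB mC; apply: fin_bigcap_measurable => // i /= iG.
apply: measurableI.
  by rewrite -[X in measurable X]setTI; exact: mxi.
by rewrite -[X in measurable X]setTI; exact: meta.
Qed.

Lemma seed_prob_ge0 Bs Cs : 0 <= seed_prob Bs Cs.
Proof. by rewrite /seed_prob; elim/big_ind : _ => // *; exact: mule_ge0. Qed.

Lemma seed_prob_fin_num Bs Cs : (forall i, measurable (Bs i)) ->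
  (forall i, measurable (Cs i)) -> seed_prob Bs Cs \is a fin_num.
Proof.
move=> mB mC; rewrite /seed_prob; elim/big_ind : _ => // [*|i _].
  exact: fin_numM.
by apply: fin_numM; exact: fin_num_measure.
Qed.

Lemma seed_eventT : seed_event (fun=> setT) (fun=> setT) = setT.
Proof. by apply/seteqP; split => // w _ i _; split. Qed.

Lemma seed_probT : seed_prob (fun=> setT) (fun=> setT) = 1.
Proof. by apply: big1 => i _; rewrite !probability_setT mule1. Qed.

(** Filling one trivial slot of a product event isolates a single seed, so the joint freshness
    hypothesis yields statements about that seed alone. *)
Definition upd {T} (F : 'I_n -> set T) i B := fun j => if j == i then B else F j.

Lemma seed_event_updl Bs Cs i B : i \in Gs -> Bs i = setT ->
  seed_event (upd Bs i B) Cs = xi i @^-1` B `&` seed_event Bs Cs.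
Proof.
move=> iG BiT; apply/seteqP; split=> w.
  move=> h; split; first by have [] := h i iG; rewrite /upd eqxx.
  move=> j jG; have [] := h j jG; rewrite /upd; case: eqVneq => // -> _ c.
  by rewrite BiT.
move=> [Bi h] j jG; have [b c] := h j jG; split => //=.
by rewrite /upd; case: eqVneq => // ->.
Qed.

Lemma seed_event_updr Bs Cs i C : i \in Gs -> Cs i = setT ->
  seed_event Bs (upd Cs i C) = eta i @^-1` C `&` seed_event Bs Cs.
Proof.
move=> iG CiT; apply/seteqP; split=> w.
  move=> h; split; first by have [] := h i iG; rewrite /upd eqxx.
  move=> j jG; have [] := h j jG; rewrite /upd; case: eqVneq => // -> b _.
  by rewrite CiT.
move=> [Ci h] j jG; have [b c] := h j jG; split => //=.
by rewrite /upd; case: eqVneq => // ->.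
Qed.

Lemma seed_prob_updl Bs Cs i B : i \in Gs -> Bs i = setT ->
  seed_prob (upd Bs i B) Cs = nu i B * seed_prob Bs Cs.
Proof.
move=> iG BiT; rewrite /seed_prob (bigD1 i)//= [in RHS](bigD1 i)//=.
rewrite /upd eqxx BiT probability_setT mul1e muleA; congr (_ * _).
by apply: eq_bigr => j /andP[_ /negbTE ->].
Qed.

Lemma seed_prob_updr Bs Cs i C : i \in Gs -> Cs i = setT ->
  seed_prob Bs (upd Cs i C) = nuQ C * seed_prob Bs Cs.
Proof.
move=> iG CiT; rewrite /seed_prob (bigD1 i)//= [in RHS](bigD1 i)//=.
rewrite /upd eqxx CiT probability_setT mule1 (muleC (nu i (Bs i))) -muleA; congr (_ * (_ * _)).
by apply: eq_bigr => j /andP[_ /negbTE ->].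
Qed.

Section step.
Context {dV} {T : measurableType dV}.
Variables (V : Omega -> T) (UX UE : {set 'I_n}).
Hypotheses (mV : measurable_fun setT V) (fV : fresh V UX UE).

Let mupd {dX} {X : measurableType dX} (F : 'I_n -> set X) i B :
  (forall j, measurable (F j)) -> measurable B -> forall j, measurable (upd F i B j).
Proof. by move=> mF mB j; rewrite /upd; case: ifP. Qed.

Let updT {X} (F : 'I_n -> set X) (U : {set 'I_n}) i B : i \notin U ->
  (forall j, j \in U -> F j = setT) -> forall j, j \in U -> upd F i B j = setT.
Proof.
move=> iU FT j jU; rewrite /upd; case: eqVneq => [ji|_]; last exact: FT.
by rewrite -ji jU in iU.
Qed.

Lemma fresh_indep_xi i : i \in Gs -> i \notin UX -> indep_law P V (xi i) (nu i).
Proof.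
move=> iG iU B mB.
have := @fV (upd (fun=> setT) i B) (fun=> setT).
rewrite seed_event_updl// seed_eventT setIT seed_prob_updl// seed_probT mule1.
by apply => //; [exact: mupd|exact: updT].
Qed.

Lemma fresh_indep_eta i : i \in Gs -> i \notin UE -> indep_law P V (eta i) nuQ.
Proof.
move=> iG iU B mB.
have := @fV (fun=> setT) (upd (fun=> setT) i B).
rewrite seed_event_updr// seed_eventT setIT seed_prob_updr// seed_probT mule1.
by apply => //; [exact: mupd|exact: updT].
Qed.

(** A revealed seed joins the past and its index is recorded in [UX]; all other seeds stay fresh, so
    revelation can be iterated. *)
Lemma fresh_xi i : i \in Gs -> i \notin UX ->
  fresh (fun w => (V w, xi i w)) (i |: UX) UE.
Proof.
move=> iG iU Bs Cs mB mC BT CT.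
have Bi : Bs i = setT by apply: BT; rewrite setU11.
apply: (@indep_event_extend _ _ _ _ _ _ (nu i)) => //.
- exact: mxi.
- exact: measurable_seed_event.
- exact: seed_prob_fin_num.
- exact: seed_prob_ge0.
- exact: fresh_indep_xi.
move=> B mB'; rewrite -seed_event_updl// -seed_prob_updl//.
apply: fV => //; first exact: mupd.
by apply: updT => // j jU; apply: BT; rewrite inE jU orbT.
Qed.

Lemma fresh_eta i : i \in Gs -> i \notin UE ->
  fresh (fun w => (V w, eta i w)) UX (i |: UE).
Proof.
move=> iG iU Bs Cs mB mC BT CT.
have Ci : Cs i = setT by apply: CT; rewrite setU11.
apply: (@indep_event_extend _ _ _ _ _ _ nuQ) => //.
- exact: meta.
- exact: measurable_seed_event.
- exact: seed_prob_fin_num.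
- exact: seed_prob_ge0.
- exact: fresh_indep_eta.
move=> B mB'; rewrite -seed_event_updr// -(@seed_prob_updr Bs Cs i)//.
apply: fV => //; first exact: mupd.
by apply: updT => // j jU; apply: CT; rewrite inE jU orbT.
Qed.
End step.

Section coin.
Context {dY} {T : measurableType dY}.
Variables (Y : Omega -> T) (c : Omega -> bool) (p : R).
Hypotheses (mY : measurable_fun setT Y) (mc : measurable_fun setT c).
Hypothesis p01 : (0 <= p <= 1)%R.
Hypothesis cY : forall A bb Bs Cs, measurable A ->
  (forall i, measurable (Bs i)) -> (forall i, measurable (Cs i)) ->
  P (Y @^-1` A `&` (c @^-1` [set bb]) `&` seed_event Bs Cs) =
  P (Y @^-1` A) * (if bb then p else 1 - p)%:E * seed_prob Bs Cs.

Let mpre (A : set T) : measurable A -> measurable (Y @^-1` A).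
Proof. by move=> mA; rewrite -[X in measurable X]setTI; exact: mY. Qed.

Let mcpre B : measurable (c @^-1` B).
Proof. by rewrite -[X in measurable X]setTI; exact: mc. Qed.

Let coin_split (D : set Omega) (B : set bool) : measurable D ->
  P (D `&` c @^-1` B) =
  (if `[< B true >] then P (D `&` c @^-1` [set true]) else 0) +
  (if `[< B false >] then P (D `&` c @^-1` [set false]) else 0).
Proof.
move=> mD.
have mDc B' : measurable (D `&` c @^-1` B') by exact: measurableI.
have [Bt|Bt] := asboolP (B true); have [Bf|Bf] := asboolP (B false).
- rewrite -measureU//; last first.
    by apply/seteqP; split => // w [[_ /= ->] [_ /=]].
  congr (P _); rewrite -setIUr -preimage_setU; congr (_ `&` _).
  apply/seteqP; split => w _ /=; first by case: (c w); [left|right].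
  by case: (c w).
- rewrite adde0; congr (P (_ `&` _)); apply/seteqP; split => w /=.
    by case: (c w).
  by move=> ->.
- rewrite add0e; congr (P (_ `&` _)); apply/seteqP; split => w /=.
    by case: (c w).
  by move=> ->.
- rewrite adde0 -[RHS](measure0 P); congr (P _); apply/seteqP; split => // w [_ /=].
  by case: (c w).
Qed.

Let cY1 A bb : measurable A ->
  P (Y @^-1` A `&` (c @^-1` [set bb])) = P (Y @^-1` A) * (if bb then p else 1 - p)%:E.
Proof.
move=> mA; have := @cY A bb (fun=> setT) (fun=> setT) mA.
by rewrite seed_eventT setIT seed_probT mule1; apply.
Qed.

(** The hypothesis fixes one coin value at a time. Splitting a set of outcomes into its values
    leaves the seed probability as a common factor, so the coin can count as past. *)
Lemma fresh_coin : fresh (fun w => (Y w, c w)) finset.set0 finset.set0.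
Proof.
move=> Bs Cs mB mC _ _.
have mE := measurable_seed_event mB mC.
apply: indep_event_pair => //.
- exact: seed_prob_fin_num.
- exact: seed_prob_ge0.
move=> A B mA _; rewrite setIAC (coin_split B (measurableI _ _ (mpre mA) mE)).
rewrite (coin_split B (mpre mA)).
rewrite ge0_muleDl; [|by case: ifP..].
by congr (_ + _); case: ifP => _; rewrite ?mul0e// setIAC cY// cY1.
Qed.

Lemma indep_coin : indep_law P Y c (bernoulli_prob p).
Proof. by apply: indep_law_bool => // A mA; exact: cY1. Qed.
End coin.

End seeds.

Lemma centered_coord (R : realType) (d : nat) dT (T : measurableType dT)
  (rho : probability T R) (Z : T -> 'rV[R]_d) (a : 'rV[R]_d) (k : R) :
  (forall j, rho.-integrable setT (fun t => (Z t 0 j)%:E) /\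
     (\int[rho]_t (Z t 0 j)%:E = (a 0 j)%:E)%E) ->
  forall j, rho.-integrable setT (fun t => ((k *: (Z t - a)) 0 j)%:E) /\
     (\int[rho]_t ((k *: (Z t - a)) 0 j)%:E = 0)%E.
Proof.
move=> hZ j; have [iZ eZ] := hZ j.
have -> : (fun t => ((k *: (Z t - a)) 0 j)%:E) =
  (fun t => k%:E * ((Z t 0 j)%:E - (a 0 j)%:E))%E.
  by apply/funext => t; rewrite !mxE.
have ia : rho.-integrable setT (fun=> (a 0 j)%:E).
  exact: finite_measure_integrable_cst.
have iB := integrableB measurableT iZ ia.
split; first exact: integrableZl.
rewrite integralZl// integralB//= eZ integral_cst//= probability_setT mule1.
by rewrite subee// mule0.
Qed.

Lemma ge0_integral_sum_in (R : realType) dT (T : measurableType dT)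
  (mu : {measure set T -> \bar R}) (I : finType) (Q : pred I) (f : I -> T -> \bar R) :
  (forall i, Q i -> measurable_fun setT (f i)) -> (forall i t, Q i -> (0 <= f i t)%E) ->
  (\int[mu]_t (\sum_(i | Q i) f i t) = \sum_(i | Q i) \int[mu]_t f i t)%E.
Proof.
move=> mf f0; rewrite [RHS]big_mkcond/=.
under eq_integral do rewrite big_mkcond/=.
rewrite ge0_integral_sum//.
- by apply: eq_bigr => i _; case: ifP => // _; rewrite integral0.
- by move=> i; case: (boolP (Q i)) => [/mf//|_]; exact: measurable_cst.
- by move=> i t _; case: ifP => // /f0.
Qed.

(** * Sums of expected squares over the workers *)

Section sums_of_squares.
Context {R : realType} {dO : measure_display} {Omega : measurableType dO}.
Variable P : probability Omega R.
Context {d : nat} {I : finType}.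
Variable Q : pred I.
Implicit Types (F : I -> Omega -> 'rV[R]_d).

Lemma sum_Esq_le F (h : Omega -> R) : (forall i, Q i -> L2 P (F i)) ->
  P.-integrable setT (EFin \o h) ->
  (forall w, \sum_(i | Q i) sqn (F i w) <= h w) ->
  \sum_(i | Q i) Esq P (F i) <= \int[P]_w h w.
Proof.
move=> LF ih Fh; rewrite -lee_fin -sumEFin.
rewrite (eq_bigr (fun i => \int[P]_w (sqn (F i w))%:E)%E); last first.
  by move=> i Qi; rewrite L2_Esq//; exact: LF.
rewrite -ge0_integral_sum_in; last 2 first.
- by move=> i Qi; apply/measurable_EFinP; apply: measurable_sqn; have [] := LF i Qi.
- by move=> i w _; rewrite lee_fin sqn_ge0.
rewrite /Rintegral fineK; last exact: integrable_fin_num.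
have mh := measurable_int _ ih.
apply: ge0_le_integral => //.
- by move=> w _; rewrite sumEFin lee_fin; apply: sumr_ge0 => i _; exact: sqn_ge0.
- under eq_fun do rewrite sumEFin big_mkcond/=.
  apply/measurable_EFinP; apply: measurable_sum => i.
  case: (boolP (Q i)) => Qi; last exact: measurable_cst.
  by apply: measurable_sqn; have [] := LF i Qi.
- by move=> w _; rewrite sumEFin lee_fin.
Qed.

(** The double sum equals 2 |Q| sum |y_i|^2 - 2 |sum y_i|^2 in expectation. Dropping the last square
    allows any common reference point to be subtracted, not just the mean. *)
Lemma sum_Esq_pairs (y : I -> Omega -> 'rV[R]_d) : (forall i, Q i -> L2 P (y i)) ->
  \sum_(i | Q i) \sum_(l | Q l) Esq P (fun w => y i w - y l w) <=
  2 * #|Q|%:R * \sum_(i | Q i) Esq P (y i).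
Proof.
move=> Ly.
have EB i l : Q i -> Q l -> Esq P (fun w => y i w - y l w) =
    Esq P (y i) + Esq P (y l) - 2 * Edot P (y i) (y l).
  move=> Qi Ql; have := EsqD (Ly i Qi) (L2Z (-1) (Ly l Ql)).
  under eq_fun do rewrite scaleN1r.
  move=> ->; rewrite EsqZ ?sqrrN ?expr1n ?mul1r; last exact: Ly.
  congr (_ + _); rewrite -mulrN; congr (_ * _).
  by rewrite EdotZr ?mulN1r//; exact: Ly.
set s := fun w => \sum_(i | Q i) y i w.
have Ls : L2 P s by exact: L2_sum.
have e i : Q i -> \sum_(l | Q l) Esq P (fun w => y i w - y l w) =
    #|Q|%:R * Esq P (y i) + \sum_(l | Q l) Esq P (y l) - 2 * Edot P (y i) s.
  move=> Qi; under eq_bigr do rewrite EB//.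
  rewrite !big_split/= sumr_const mulr_natl sumrN -mulr_sumr.
  rewrite (EdotC P (y i) s) Edot_suml//; last exact: Ly.
  by congr (_ - 2 * _); apply: eq_bigr => l _; exact: EdotC.
rewrite (eq_bigr _ e) !big_split/= sumrN -!mulr_sumr sumr_const.
rewrite -Edot_suml//.
have -> : Edot P s s = Esq P s by apply: eq_Rintegral => w _; rewrite sqnE.
have := Esq_ge0 P s; rewrite -mulr_natl; lra.
Qed.

End sums_of_squares.

(** * One round of the algorithm *)

Section round.
Context {R : realType} {d n : nat} {dO : measure_display} {Omega : measurableType dO}.
Variable P : probability Omega R.
Context {dS} {S : measurableType dS} {dQ} {SQ : measurableType dQ}.
Local Notation Rd := 'rV[R]_d.
Local Notation T1 := ((Rd * Rd) * bool)%type.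
Variables (Gs : {set 'I_n}) (nu : 'I_n -> probability S R) (nuQ : probability SQ R).
Variables (Dhat : 'I_n -> Rd -> Rd -> S -> Rd) (Q : Rd -> SQ -> Rd).
Variables (gf : 'I_n -> Rd -> Rd) (gF : Rd -> Rd).
Variables (L B zeta Lpm lam omega p gamma : R).
Local Notation G := (#|Gs|%:R : R).
Hypothesis G2 : (2 <= #|Gs|)%N.
Hypothesis gFE : forall x, gF x = G^-1 *: \sum_(i in Gs) gf i x.
Hypothesis gF_lip : forall x y, sqn (gF x - gF y) <= L ^+ 2 * sqn (x - y).
Hypothesis gf_het : forall x,
  G^-1 * \sum_(i in Gs) sqn (gf i x - gF x) <= B * sqn (gF x) + zeta ^+ 2.
Hypothesis gf_var : forall x y, G^-1 * \sum_(i in Gs) sqn (gf i x - gf i y)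
  - sqn (gF x - gF y) <= Lpm ^+ 2 * sqn (x - y).
Hypothesis B0 : 0 <= B.
Hypothesis mDhat : forall i, i \in Gs ->
  measurable_fun setT (fun z : (Rd * Rd) * S => Dhat i z.1.1 z.1.2 z.2).
Hypothesis EDhat : forall i x y (j : 'I_d), i \in Gs ->
  (nu i).-integrable setT (fun s => (Dhat i x y s 0 j)%:E) /\
  (\int[nu i]_s (Dhat i x y s 0 j)%:E = ((gf i x - gf i y) 0 j)%:E)%E.
Hypothesis VDhat : forall x y,
  ((G^-1)%:E * \sum_(i in Gs) \int[nu i]_s (sqn (Dhat i x y s - (gf i x - gf i y)))%:E
   <= (lam * sqn (x - y))%:E)%E.
Hypothesis omega0 : 0 <= omega.
Hypothesis mQ : measurable_fun setT (fun z : Rd * SQ => Q z.1 z.2).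
Hypothesis EQ : forall x (j : 'I_d),
  nuQ.-integrable setT (fun s => (Q x s 0 j)%:E) /\
  (\int[nuQ]_s (Q x s 0 j)%:E = (x 0 j)%:E)%E.
Hypothesis VQ : forall x, (\int[nuQ]_s (sqn (Q x s - x))%:E <= (omega * sqn x)%:E)%E.
Hypothesis p01 : 0 <= p <= 1.

Variables (x g : Omega -> Rd) (c : Omega -> bool).
Variables (xi : 'I_n -> Omega -> S) (eta : 'I_n -> Omega -> SQ).
Hypothesis mx : measurable_fun setT x.
Hypothesis mg : measurable_fun setT g.
Hypothesis mc : measurable_fun setT c.
Hypothesis mxi : forall i, i \in Gs -> measurable_fun setT (xi i).
Hypothesis meta : forall i, i \in Gs -> measurable_fun setT (eta i).
Hypothesis fresh_seeds : forall (A : set (Rd * Rd)) bb Bs Cs, measurable A ->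
  (forall i, measurable (Bs i)) -> (forall i, measurable (Cs i)) ->
  P ((fun w => (x w, g w)) @^-1` A `&` (c @^-1` [set bb]) `&` seed_event Gs xi eta Bs Cs) =
  (P ((fun w => (x w, g w)) @^-1` A) * (if bb then p else 1 - p)%:E
    * seed_prob Gs nu nuQ Bs Cs)%E.
Hypothesis Lgrad : L2 P (fun w => gF (x w)).
Hypothesis Lerr : L2 P (fun w => g w - gF (x w)).

Let xp w : Rd := x w - gamma *: g w.
Let dx w : Rd := xp w - x w.
Let Y w := (x w, g w).
Let V1 w : T1 := (Y w, c w).

Let nn (v : T1) : R := (~~ v.2)%:R.
Let next (v : T1) : Rd := v.1.1 - gamma *: v.1.2.
Let delta i (v : T1) : Rd := gf i (next v) - gf i v.1.1.

(* [nn] is the indicator of a compressed round ([c_k = 0]); [est i] and [comp i] are the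
   centred estimation and compression errors of worker [i], as functions of the past,
   the coin and the seeds. *)
Let est i (z : T1 * S) : Rd :=
  nn z.1 *: (Dhat i (next z.1) z.1.1.1 z.2 - delta i z.1).
Let comp i (z : (T1 * S) * SQ) : Rd :=
  nn z.1.1 *: (Q (Dhat i (next z.1.1) z.1.1.1.1 z.1.2) z.2
               - Dhat i (next z.1.1) z.1.1.1.1 z.1.2).
Let err i (z : (T1 * S) * SQ) : Rd := comp i z + est i z.1.

Let V2 i w := (V1 w, xi i w).
Let V3 i w := (V2 i w, eta i w).

Let G0 : 0 < G. Proof. by rewrite ltr0n; apply: leq_trans G2. Qed.

Let mY : measurable_fun setT Y.
Proof. exact: measurable_fun_pair. Qed.
Let mV1 : measurable_fun setT V1.
Proof. exact: measurable_fun_pair. Qed.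
Let mV2 i : i \in Gs -> measurable_fun setT (V2 i).
Proof. by move=> iG; apply: measurable_fun_pair => //; exact: mxi. Qed.
Let mV3 i : i \in Gs -> measurable_fun setT (V3 i).
Proof. by move=> iG; apply: measurable_fun_pair; [exact: mV2|exact: meta]. Qed.

Let fresh1 : fresh P Gs nu nuQ xi eta V1 finset.set0 finset.set0.
Proof. exact: fresh_coin fresh_seeds. Qed.

Let sqn_nn v (u : Rd) : sqn (nn v *: u) = nn v * sqn u.
Proof. by rewrite sqnZ /nn; case: v.2; rewrite ?expr0n ?expr1n. Qed.

Let mnext : measurable_fun setT next.
Proof.
have m11 : measurable_fun setT (fun v : T1 => v.1.1) by exact: measurableT_comp.
have m12 : measurable_fun setT (fun v : T1 => v.1.2) by exact: measurableT_comp.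
by apply: measurable_rVB => //; apply: measurable_rVZ.
Qed.

Let mnn : measurable_fun setT nn.
Proof.
have mb : measurable_fun setT (fun b : bool => (~~ b)%:R : R) by [].
exact: (measurableT_comp mb).
Qed.

(** One worker is bounded by the whole sum, at the price of a factor G. This crude constant serves
    measurability and square-integrability; the rate uses the averaged bounds. *)
Lemma local_grad_lip i y z : i \in Gs ->
  sqn (gf i y - gf i z) <= (G * (L ^+ 2 + Lpm ^+ 2)) * sqn (y - z).
Proof.
move=> iG; apply: (@le_trans _ _ (\sum_(i in Gs) sqn (gf i y - gf i z))).
  by rewrite (bigD1 i)//= lerDl; apply: sumr_ge0 => *; exact: sqn_ge0.
have := gf_var y z; have := gF_lip y z => h1 h2.
rewrite -mulrA -ler_pdivrMl//; lra.
Qed.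

Lemma measurable_local_grad i : i \in Gs -> measurable_fun setT (gf i).
Proof. by move=> iG; apply: lipschitz_measurable_rV => y z; exact: local_grad_lip. Qed.

Let mgF : measurable_fun setT gF.
Proof. exact: lipschitz_measurable_rV gF_lip. Qed.

Let m11 : measurable_fun setT (fun v : T1 => v.1.1).
Proof. exact: measurableT_comp. Qed.

Let mdelta i : i \in Gs -> measurable_fun setT (delta i).
Proof.
move=> iG; apply: measurable_rVB; apply: measurableT_comp => //; exact: measurable_local_grad.
Qed.

Let mDh i : i \in Gs ->
  measurable_fun setT (fun z : T1 * S => Dhat i (next z.1) z.1.1.1 z.2).
Proof.
move=> iG.
have -> : (fun z : T1 * S => Dhat i (next z.1) z.1.1.1 z.2) =
  (fun z : (Rd * Rd) * S => Dhat i z.1.1 z.1.2 z.2) \o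
  (fun z : T1 * S => ((next z.1, z.1.1.1), z.2)) by [].
apply: measurableT_comp; first exact: mDhat.
apply: measurable_fun_pair => //; apply: measurable_fun_pair.
  exact: measurableT_comp.
exact: (measurableT_comp m11 measurable_fst).
Qed.

Let mest i : i \in Gs -> measurable_fun setT (est i).
Proof.
move=> iG; apply: measurable_rVZ; first exact: measurableT_comp.
apply: measurable_rVB; first exact: mDh.
by apply: measurableT_comp => //; exact: mdelta.
Qed.

Let mcomp i : i \in Gs -> measurable_fun setT (comp i).
Proof.
move=> iG.
have m1 : measurable_fun setT (fun z : (T1 * S) * SQ => Dhat i (next z.1.1) z.1.1.1.1 z.1.2).
  exact: (measurableT_comp (mDh iG) measurable_fst).
apply: measurable_rVZ.
  exact: (measurableT_comp (measurableT_comp mnn measurable_fst) measurable_fst).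
apply: measurable_rVB => //.
have -> : (fun z : (T1 * S) * SQ => Q (Dhat i (next z.1.1) z.1.1.1.1 z.1.2) z.2) =
  (fun z : Rd * SQ => Q z.1 z.2) \o
  (fun z : (T1 * S) * SQ => (Dhat i (next z.1.1) z.1.1.1.1 z.1.2, z.2)) by [].
by apply: measurableT_comp => //; exact: measurable_fun_pair.
Qed.

Let Lg : L2 P g.
Proof. by have := L2D Lerr Lgrad; under eq_fun do rewrite subrK. Qed.

Let dxE w : dx w = (- gamma) *: g w.
Proof. by rewrite /dx /xp addrAC subrr add0r scaleNr. Qed.

Let Ldx : L2 P dx.
Proof. by have := L2Z (- gamma) Lg; under eq_fun do rewrite -dxE. Qed.

Let L2_nn (X : Omega -> Rd) : L2 P X -> L2 P (fun w => nn (V1 w) *: X w).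
Proof.
move=> LX; have [mX _] := LX; apply: (@L2_leZ _ _ _ _ _ 1 _ X) => // [|w].
  by apply: measurable_rVZ => //; exact: measurableT_comp.
by rewrite sqn_nn /nn mul1r; case: (V1 w).2; rewrite ?mul0r ?mul1r ?sqn_ge0.
Qed.

Let Ldelta i : i \in Gs -> L2 P (fun w => nn (V1 w) *: delta i (V1 w)).
Proof.
move=> iG; apply: L2_nn.
apply: (@L2_leZ _ _ _ _ _ (G * (L ^+ 2 + Lpm ^+ 2)) _ dx) => //.
  by apply: measurableT_comp => //; exact: mdelta.
by move=> w; exact: local_grad_lip.
Qed.

Let integral_est i : i \in Gs -> (\int[P]_w (sqn (est i (V2 i w)))%:E =
  \int[P]_w \int[nu i]_s (sqn (est i (V1 w, s)))%:E)%E.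
Proof.
move=> iG; pose h z := (sqn (est i z))%:E.
have mh : measurable_fun setT h.
  by apply/measurable_EFinP; apply: measurable_sqn; exact: mest.
have ind := fresh_indep_xi fresh1 iG (negbT (finset.in_set0 i)).
by apply: (ge0_indep_law_integral mV1 (mxi iG) ind mh) => z; rewrite lee_fin sqn_ge0.
Qed.

(** (A4) bounds only the average over workers, so the sum is estimated in the extended reals first;
    finiteness of each term is read off from it afterwards in [Lest]. *)
Let sum_integral_est : (\sum_(i in Gs) \int[P]_w (sqn (est i (V2 i w)))%:E <=
  (G * lam * Esq P (fun w => nn (V1 w) *: dx w))%:E)%E.
Proof.
rewrite (eq_bigr _ integral_est).
have mI i : i \in Gs ->
    measurable_fun setT (fun w => \int[nu i]_s (sqn (est i (V1 w, s)))%:E)%E.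
  move=> iG.
  have mh : measurable_fun setT (fun z => (sqn (est i z))%:E).
    by apply/measurable_EFinP; apply: measurable_sqn; exact: mest.
  have mF : measurable_fun setT (fubini_F (nu i) (fun z => (sqn (est i z))%:E)).
    by apply: measurable_fun_fubini_tonelli_F => // z; rewrite lee_fin sqn_ge0.
  exact: (measurableT_comp mF mV1).
rewrite -ge0_integral_sum_in//; last first.
  by move=> i w _; apply: integral_ge0 => s _; rewrite lee_fin sqn_ge0.
have Ldx' := L2_nn Ldx.
have -> : (G * lam * Esq P (fun w => nn (V1 w) *: dx w))%:E =
   (\int[P]_w (G * lam * sqn (nn (V1 w) *: dx w))%:E)%E.
  under [RHS]eq_integral do rewrite EFinM.
  by rewrite integralZl//; [rewrite L2_Esq|have [] := Ldx'].
apply: ge0_le_integral => //.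
- move=> w _; apply: sume_ge0 => i _; apply: integral_ge0 => s _.
  by rewrite lee_fin sqn_ge0.
- under eq_fun do rewrite big_mkcond/=.
  apply: emeasurable_sum => i; case: (boolP (i \in Gs)) => [/mI//|_].
  exact: measurable_cst.
- exact: measurable_int (integrable_sqnZ _ Ldx').
move=> w _; rewrite /est /nn/=; case: (c w) => /=.
  rewrite scale0r sqn0 mulr0 big1// => i _.
  by under eq_integral do rewrite scale0r sqn0; rewrite integral0.
rewrite scale1r; under eq_bigr do under eq_integral do rewrite scale1r.
by have := VDhat (xp w) (x w); rewrite lee_pdivrMl// -EFinM mulrA.
Qed.

Let Lest i : i \in Gs -> L2 P (fun w => est i (V2 i w)).
Proof.
move=> iG; apply: L2_lty.
  by apply: measurableT_comp; [exact: mest|exact: mV2].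
apply: le_lt_trans (ltry _); apply: le_trans sum_integral_est.
rewrite (bigD1 i)//= leeDl// sume_ge0// => l _.
by apply: integral_ge0 => w _; rewrite lee_fin sqn_ge0.
Qed.

Let sum_Esq_est : \sum_(i in Gs) Esq P (fun w => est i (V2 i w)) <=
  G * lam * Esq P (fun w => nn (V1 w) *: dx w).
Proof.
rewrite -lee_fin -sumEFin (eq_bigr _ (fun i iG => esym (L2_Esq (Lest iG)))).
exact: sum_integral_est.
Qed.

Let dhat i w : Rd := nn (V1 w) *: Dhat i (xp w) (x w) (xi i w).

Let dhatE i w : dhat i w = nn (V1 w) *: delta i (V1 w) + est i (V2 i w).
Proof. by rewrite /dhat /est -scalerDr addrC subrK. Qed.

Let Ldhat i : i \in Gs -> L2 P (dhat i).
Proof.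
move=> iG; have := L2D (Ldelta iG) (Lest iG).
by under eq_fun do rewrite -dhatE.
Qed.

(** The variance of the compressor is relative to its input, which depends on [xi i]. Hence [xi i]
    is revealed before [eta i] is integrated out. *)
Let integral_comp i : i \in Gs -> (\int[P]_w (sqn (comp i (V3 i w)))%:E <=
  (omega * Esq P (dhat i))%:E)%E.
Proof.
move=> iG; pose h z := (sqn (comp i z))%:E.
have mh : measurable_fun setT h.
  by apply/measurable_EFinP; apply: measurable_sqn; exact: mcomp.
have h0 z : (0 <= h z)%E by rewrite lee_fin sqn_ge0.
have f2 := fresh_xi mxi meta mV1 fresh1 iG (negbT (finset.in_set0 i)).
have ind := fresh_indep_eta f2 iG (negbT (finset.in_set0 i)).
rewrite (ge0_indep_law_integral (mV2 iG) (meta iG) ind mh)//.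
have -> : (omega * Esq P (dhat i))%:E = (\int[P]_w (omega * sqn (dhat i w))%:E)%E.
  under [RHS]eq_integral do rewrite EFinM.
  rewrite integralZl//; first by rewrite L2_Esq//; exact: Ldhat.
  by have [] := Ldhat iG.
apply: ge0_le_integral => //.
- by move=> w _; exact: integral_ge0.
- have mF : measurable_fun setT (fubini_F nuQ h).
    exact: measurable_fun_fubini_tonelli_F.
  exact: (measurableT_comp mF (mV2 iG)).
- exact: measurable_int (integrable_sqnZ _ (Ldhat iG)).
move=> w _; rewrite /h /comp /dhat /nn/=; case: (c w) => /=.
  under eq_integral do rewrite scale0r sqn0.
  by rewrite integral0 lee_fin scale0r sqn0 mulr0.
under eq_integral do rewrite scale1r.
by rewrite scale1r; exact: VQ.
Qed.

Let Lcomp i : i \in Gs -> L2 P (fun w => comp i (V3 i w)).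
Proof.
move=> iG; apply: L2_lty; last exact: le_lt_trans (integral_comp iG) (ltry _).
by apply: measurableT_comp; [exact: mcomp|exact: mV3].
Qed.

Let Esq_comp i : i \in Gs ->
  Esq P (fun w => comp i (V3 i w)) <= omega * Esq P (dhat i).
Proof.
by move=> iG; rewrite -lee_fin -L2_Esq ?integral_comp//; exact: Lcomp.
Qed.

Let Lerri i : i \in Gs -> L2 P (fun w => err i (V3 i w)).
Proof. by move=> iG; apply: L2D; [exact: Lcomp|exact: Lest]. Qed.

(** * Orthogonality of fresh errors to everything already revealed *)

Section orthogonality.
Context {dV} {T : measurableType dV}.
Variables (V : Omega -> T) (pr : T -> T1) (UX UE : {set 'I_n}) (a : T -> Rd) (i : 'I_n).
Hypotheses (mV : measurable_fun setT V) (mpr : measurable_fun setT pr).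
Hypotheses (fV : fresh P Gs nu nuQ xi eta V UX UE) (prV : forall w, pr (V w) = V1 w).
Hypotheses (iG : i \in Gs) (iUX : i \notin UX) (iUE : i \notin UE).
Hypotheses (ma : measurable_fun setT a) (La : L2 P (fun w => a (V w))).

Let orth_est : Edot P (fun w => a (V w)) (fun w => est i (V2 i w)) = 0.
Proof.
pose h (z : T * S) := est i (pr z.1, z.2).
have mh : measurable_fun setT h.
  have -> : h = est i \o (fun z : T * S => (pr z.1, z.2)) by [].
  apply: measurableT_comp; first exact: mest.
  by apply: measurable_fun_pair => //; exact: measurableT_comp.
have hE : (fun w => h (V w, xi i w)) = (fun w => est i (V2 i w)).
  by apply/funext => w; rewrite /h /= prV.
have ind := fresh_indep_xi fV iG iUX.
rewrite -hE; apply: (indep_law_dot0 mV (mxi iG) ind ma mh) => //.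
  by rewrite hE; exact: Lest.
move=> v; apply: (@centered_coord _ _ _ _ (nu i)
  (Dhat i (next (pr v)) (pr v).1.1) (delta i (pr v)) (nn (pr v))) => j.
exact: EDhat.
Qed.

Let orth_comp : Edot P (fun w => a (V w)) (fun w => comp i (V3 i w)) = 0.
Proof.
pose h (z : (T * S) * SQ) := comp i ((pr z.1.1, z.1.2), z.2).
have mh : measurable_fun setT h.
  have -> : h = comp i \o (fun z : (T * S) * SQ => ((pr z.1.1, z.1.2), z.2)) by [].
  apply: measurableT_comp; first exact: mcomp.
  apply: measurable_fun_pair => //; apply: measurable_fun_pair.
    exact: (measurableT_comp (measurableT_comp mpr measurable_fst) measurable_fst).
  exact: measurableT_comp.
pose W w := (V w, xi i w).
have mW : measurable_fun setT W by apply: measurable_fun_pair => //; exact: mxi.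
have hE : (fun w => h (W w, eta i w)) = (fun w => comp i (V3 i w)).
  by apply/funext => w; rewrite /h /= prV.
have fW := fresh_xi mxi meta mV fV iG iUX.
have ind := fresh_indep_eta fW iG iUE.
have ma' : measurable_fun setT (fun z : T * S => a z.1) by exact: measurableT_comp.
rewrite -hE; apply: (indep_law_dot0 mW (meta iG) ind ma' mh) => //.
  by rewrite hE; exact: Lcomp.
move=> v; apply: (@centered_coord _ _ _ _ nuQ
  (Q (Dhat i (next (pr v.1)) (pr v.1).1.1 v.2))
  (Dhat i (next (pr v.1)) (pr v.1).1.1 v.2) (nn (pr v.1))) => j.
exact: EQ.
Qed.

Let orth_err : Edot P (fun w => a (V w)) (fun w => err i (V3 i w)) = 0.
Proof.
rewrite EdotC EdotDl//; [|exact: Lcomp|exact: Lest].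
by rewrite EdotC orth_comp EdotC orth_est addr0.
Qed.

(** [V] may be any enlargement of (past, coin), recovered by [pr], that has not revealed the seeds
    of worker [i]. Taking [V1] gives orthogonality to the past, and taking [V3 l] with l <> i gives
    orthogonality between two workers. *)
Lemma orthogonality : [/\ Edot P (fun w => a (V w)) (fun w => est i (V2 i w)) = 0,
  Edot P (fun w => a (V w)) (fun w => comp i (V3 i w)) = 0 &
  Edot P (fun w => a (V w)) (fun w => err i (V3 i w)) = 0].
Proof. by []. Qed.
End orthogonality.

(** Source of the factors p and 1 - p: [f] will be the indicator of a full or of a compressed round,
    and [k] depends on the past only. *)
Lemma coin_Rintegral (f : bool -> R) (k : Rd * Rd -> R) : (forall b, 0 <= f b) ->
  (forall y, 0 <= k y) -> measurable_fun setT k ->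
  P.-integrable setT (EFin \o (fun w => k (Y w))) ->
  \int[P]_w (f (c w) * k (Y w)) =
  (p * f true + (1 - p) * f false) * \int[P]_w k (Y w).
Proof.
move=> f0 k0 mk ik; rewrite -RintegralZl// /Rintegral; congr fine.
pose h (z : (Rd * Rd) * bool) := (f z.2 * k z.1)%:E.
have mf : measurable_fun setT f by [].
have mh : measurable_fun setT h.
  by apply/measurable_EFinP; apply: measurable_funM; exact: measurableT_comp.
have ind := indep_coin mY mc p01 fresh_seeds.
rewrite (ge0_indep_law_integral mY mc ind mh); last first.
  by move=> z; rewrite lee_fin mulr_ge0.
apply: eq_integral => w _; rewrite integral_bernoulli_prob//=; last first.
  by move=> b; rewrite lee_fin mulr_ge0.
by rewrite /unstable.onem -!EFinM -EFinD; congr EFin; ring.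
Qed.

Let nn_Esq (h : Rd * Rd -> Rd) : measurable_fun setT h -> L2 P (fun w => h (Y w)) ->
  Esq P (fun w => nn (V1 w) *: h (Y w)) = (1 - p) * Esq P (fun w => h (Y w)).
Proof.
move=> mh [_ ih].
transitivity (\int[P]_w ((~~ c w)%:R * sqn (h (Y w)))).
  by apply: eq_Rintegral => w _; exact: sqn_nn.
rewrite (@coin_Rintegral (fun b => (~~ b)%:R) (fun y => sqn (h y)))//.
- by rewrite /= mulr0 add0r mulr1.
- by move=> y; exact: sqn_ge0.
- exact: measurable_sqn.
Qed.

Let Esq_nn_dx : Esq P (fun w => nn (V1 w) *: dx w) = (1 - p) * Esq P dx.
Proof.
have mh : measurable_fun setT (fun y : Rd * Rd => - gamma *: y.2).
  exact: measurable_rVZ.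
have hY : (fun w => - gamma *: (Y w).2) = dx.
  by apply/funext => w; rewrite dxE.
have Lh : L2 P (fun w => - gamma *: (Y w).2) by rewrite hY.
rewrite -[in RHS]hY -(nn_Esq mh Lh); apply: eq_Rintegral => w _.
by rewrite dxE.
Qed.

Let Esq_dhat i : i \in Gs -> Esq P (dhat i) =
  Esq P (fun w => nn (V1 w) *: delta i (V1 w)) + Esq P (fun w => est i (V2 i w)).
Proof.
move=> iG.
have md : measurable_fun setT (fun v : T1 => nn v *: delta i v).
  by apply: measurable_rVZ => //; exact: mdelta.
have [ort _ _] := orthogonality mV1 (@measurable_id _ T1 setT) fresh1 (fun=> erefl)
  iG (negbT (finset.in_set0 i)) (negbT (finset.in_set0 i)) md (Ldelta iG).
have := EsqD (Ldelta iG) (Lest iG); rewrite ort mulr0 addr0 => <-.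
by apply: eq_Rintegral => w _; rewrite dhatE.
Qed.

(** [orthogonality] does not cover this pair, since [est i] already uses the seed [xi i] of the same
    worker. Here [xi i] belongs to the past and the compression seed alone is fresh. *)
Let Esq_err i : i \in Gs -> Esq P (fun w => err i (V3 i w)) =
  Esq P (fun w => comp i (V3 i w)) + Esq P (fun w => est i (V2 i w)).
Proof.
move=> iG.
have f2 := fresh_xi mxi meta mV1 fresh1 iG (negbT (finset.in_set0 i)).
have ind := fresh_indep_eta f2 iG (negbT (finset.in_set0 i)).
have ort : Edot P (fun w => est i (V2 i w)) (fun w => comp i (V3 i w)) = 0.
  apply: (indep_law_dot0 (mV2 iG) (meta iG) ind (mest iG) (mcomp iG)).
  - exact: Lest.
  - exact: Lcomp.
  move=> v; apply: (@centered_coord _ _ _ _ nuQ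
    (Q (Dhat i (next v.1) v.1.1.1 v.2)) (Dhat i (next v.1) v.1.1.1 v.2)
    (nn v.1)) => j.
  exact: EQ.
by rewrite EsqD ?(EdotC _ (fun w => comp i _)) ?ort ?mulr0 ?addr0//;
  [exact: Lcomp|exact: Lest].
Qed.

(** Compression costs omega (|delta|^2 + |est|^2) and estimation |est|^2 more, hence the weights
    omega and 1 + omega. (A3) with smoothness bounds the average of |delta|^2 by (L^2 + Lpm^2)
    |dx|^2. *)
Let Esq_err_le : \sum_(i in Gs) Esq P (fun w => err i (V3 i w)) <=
  G * (1 - p) * (omega * (L ^+ 2 + Lpm ^+ 2) + (1 + omega) * lam) * Esq P dx.
Proof.
have h1 : \sum_(i in Gs) Esq P (fun w => nn (V1 w) *: delta i (V1 w)) <=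
    G * (L ^+ 2 + Lpm ^+ 2) * ((1 - p) * Esq P dx).
  rewrite -Esq_nn_dx.
  have [_ i1] := L2_nn Ldx; rewrite -RintegralZl//.
  apply: sum_Esq_le => [i iG||w].
  - exact: Ldelta.
  - by apply: integrable_sqnZ; exact: L2_nn.
  - under eq_bigr do rewrite sqn_nn.
    rewrite -mulr_sumr sqn_nn mulrCA ler_wpM2l//.
    have := gf_var (xp w) (x w); have := gF_lip (xp w) (x w) => h1 h2.
    rewrite -mulrA -ler_pdivrMl//; rewrite -/(dx w) in h1 h2; lra.
have h2 := sum_Esq_est; rewrite Esq_nn_dx in h2.
have h3 : \sum_(i in Gs) Esq P (fun w => err i (V3 i w)) <=
    omega * (\sum_(i in Gs) Esq P (fun w => nn (V1 w) *: delta i (V1 w)))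
    + (1 + omega) * \sum_(i in Gs) Esq P (fun w => est i (V2 i w)).
  rewrite !mulr_sumr -big_split/=; apply: ler_sum => i iG.
  rewrite Esq_err// [X in _ <= _ + X]mulrDl mul1r [X in _ <= _ + X]addrC addrA.
  by rewrite -mulrDr lerD2r -Esq_dhat// Esq_comp.
have h4 := ler_wpM2l omega0 h1.
have h5 : (1 + omega) * (\sum_(i in Gs) Esq P (fun w => est i (V2 i w))) <=
    (1 + omega) * (G * lam * ((1 - p) * Esq P dx)).
  by apply: ler_wpM2l => //; rewrite addr_ge0.
apply: le_trans h3 _; apply: le_trans (lerD h4 h5) _.
by rewrite le_eqVlt; apply/orP; left; apply/eqP; ring.
Qed.

Lemma L2_grad_next : L2 P (fun w => gF (xp w)).
Proof.
apply: (@L2_le _ _ _ _ _ _ (fun w => 2 * sqn (gF (x w)) + (2 * L ^+ 2) * sqn (dx w))).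
- apply: measurableT_comp => //; apply: measurable_rVB => //.
  exact: measurable_rVZ.
- by apply: integrable_EFinD; exact: integrable_sqnZ.
move=> w; have := sqnD_le2 (gF (x w)) (gF (xp w) - gF (x w)).
by rewrite addrC subrK; have := gF_lip (xp w) (x w); rewrite -/(dx w); lra.
Qed.

(** Needed because full-gradient messages are compared through (A2) at the new iterate, while
    descent controls the gradient at the old one. *)
Lemma Esq_grad_next :
  Esq P (fun w => gF (xp w)) <= 2 * Esq P (fun w => gF (x w)) + 2 * L ^+ 2 * Esq P dx.
Proof.
have i1 := integrable_sqnZ 2 Lgrad; have i2 := integrable_sqnZ (2 * L ^+ 2) Ldx.
have [_ j1] := Lgrad; have [_ j2] := Ldx; have [_ j3] := L2_grad_next.
rewrite -!RintegralZl// -RintegralD//; apply: le_Rintegral => //.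
  exact: integrable_EFinD.
move=> w _; have := sqnD_le2 (gF (x w)) (gF (xp w) - gF (x w)).
by rewrite addrC subrK; have := gF_lip (xp w) (x w); rewrite -/(dx w); lra.
Qed.

(** * Average and spread of the good messages *)

Let msg i w : Rd := if c w then gf i (xp w)
  else g w + Q (Dhat i (xp w) (x w) (xi i w)) (eta i w).
Let gbar w : Rd := G^-1 *: \sum_(i in Gs) msg i w.

Let Lu : L2 P (fun w => nn (V1 w) *: (g w - gF (x w))).
Proof. exact: L2_nn. Qed.

(** In a full round the average is the exact gradient and both sides vanish. In a compressed round
    the increments [delta i] average to the increment of [gF], which leaves the old error plus
    centred terms. *)
Let gbarE w : gbar w - gF (xp w) = nn (V1 w) *: (g w - gF (x w))
  + \sum_(i in Gs) G^-1 *: err i (V3 i w).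
Proof.
rewrite /gbar /err /comp /est /msg /nn /=; case: (c w) => /=.
  rewrite -gFE subrr scale0r add0r big1// => i _.
  by rewrite !scale0r addr0 scaler0.
rewrite scale1r -scaler_sumr.
under [in RHS]eq_bigr do rewrite !scale1r addrA subrK.
set q := fun i => Q (Dhat i (xp w) (x w) (xi i w)) (eta i w).
have -> : \sum_(i in Gs) (g w + q i) = G *: g w + \sum_(i in Gs) q i.
  by rewrite big_split/= sumr_const scaler_nat.
have -> : \sum_(i in Gs) (q i - delta i (x w, g w, false)) =
    \sum_(i in Gs) q i - G *: (gF (xp w) - gF (x w)).
  rewrite sumrB; congr (_ - _).
  by rewrite /delta/= sumrB !gFE -scalerBr scalerA mulfV ?gt_eqF// scale1r.
rewrite scalerDr scalerBr !scalerA mulVf ?gt_eqF// !scale1r.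
by apply/rowP => j; rewrite !mxE; ring.
Qed.

Let Esq_gbar : L2 P (fun w => gbar w - gF (xp w)) /\
  Esq P (fun w => gbar w - gF (xp w)) <= (1 - p) * Esq P (fun w => g w - gF (x w))
   + (1 - p) * (omega * (L ^+ 2 + Lpm ^+ 2) + (1 + omega) * lam) / G * Esq P dx.
Proof.
have LGe i : i \in Gs -> L2 P (fun w => G^-1 *: err i (V3 i w)).
  by move=> iG; apply: L2Z; exact: Lerri.
have gbE : (fun w => gbar w - gF (xp w)) =
   (fun w => nn (V1 w) *: (g w - gF (x w)) + \sum_(i in Gs) G^-1 *: err i (V3 i w)).
  by apply/funext => w; exact: gbarE.
split; first by rewrite gbE; apply: L2D => //; exact: L2_sum.
rewrite gbE pythagoras//; last 3 first.
- exact: index_enum_uniq.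
- move=> i iG; rewrite EdotZr//; last exact: Lerri.
  have ma : measurable_fun setT (fun v : T1 => nn v *: (v.1.2 - gF v.1.1)).
    apply: measurable_rVZ => //; apply: measurable_rVB.
      exact: (measurableT_comp measurable_snd measurable_fst).
    exact: measurableT_comp.
  have [_ _ ort] := orthogonality mV1 (@measurable_id _ T1 setT) fresh1 (fun=> erefl)
    iG (negbT (finset.in_set0 i)) (negbT (finset.in_set0 i)) ma Lu.
  by rewrite ort mulr0.
- move=> i l iG lG il.
  rewrite EdotZr; [|exact: LGe|exact: Lerri].
  rewrite EdotC EdotZr; [|exact: Lerri|exact: Lerri].
  (* With both seeds of worker [i] revealed, its error is a function of the past, while the seeds of
     [l] are still fresh. *)
  have li : l \notin i |: finset.set0 by rewrite !inE orbF eq_sym.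
  have f3 := fresh_eta mxi meta (mV2 iG)
    (fresh_xi mxi meta mV1 fresh1 iG (negbT (finset.in_set0 i)))
    iG (negbT (finset.in_set0 i)).
  have me : measurable_fun setT (err i).
    apply: measurable_rVD; first exact: mcomp.
    by apply: measurableT_comp => //; exact: mest.
  have mff : measurable_fun setT (fun z : (T1 * S) * SQ => z.1.1).
    exact: (measurableT_comp measurable_fst measurable_fst).
  have [_ _ ort] := orthogonality (mV3 iG) mff f3 (fun=> erefl) lG li li me (Lerri iG).
  by rewrite EdotC ort !mulr0.
have -> : Esq P (fun w => nn (V1 w) *: (g w - gF (x w))) =
    (1 - p) * Esq P (fun w => g w - gF (x w)).
  have mh : measurable_fun setT (fun y : Rd * Rd => y.2 - gF y.1).
    by apply: measurable_rVB => //; exact: measurableT_comp.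
  exact: (nn_Esq mh Lerr).
rewrite lerD2l.
rewrite (eq_bigr (fun i => G^-1 ^+ 2 * Esq P (fun w => err i (V3 i w)))); last first.
  by move=> i iG; rewrite EsqZ//; exact: Lerri.
rewrite -mulr_sumr exprVn ler_pdivrMl ?exprn_gt0//.
apply: le_trans Esq_err_le _; rewrite le_eqVlt; apply/orP; left; apply/eqP.
by field; rewrite gt_eqF.
Qed.

Let het i w : Rd := (c w)%:R *: (gf i (xp w) - gF (xp w)).
Let dev i w : Rd := nn (V1 w) *: (delta i (V1 w) - (gF (xp w) - gF (x w))).
(* The common reference point around which the spread of the messages is measured. *)
Let ref w : Rd := if c w then gF (xp w) else g w + (gF (xp w) - gF (x w)).

Let mxp : measurable_fun setT xp.
Proof. exact: (measurableT_comp mnext mV1). Qed.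

Let msg_ref i w : msg i w - ref w = het i w + (err i (V3 i w) + dev i w).
Proof.
rewrite /msg /ref /het /err /dev /comp /est /nn /=; case: (c w) => /=.
  by rewrite !scale0r scale1r !addr0.
by rewrite !scale1r scale0r add0r; apply/rowP => j; rewrite !mxE; ring.
Qed.

(** No cross term appears: [het] lives on full rounds, the other two terms on compressed ones. *)
Let sqn_msg_ref i w :
  sqn (msg i w - ref w) = sqn (het i w) + sqn (err i (V3 i w) + dev i w).
Proof.
rewrite msg_ref /het /err /dev /comp /est /nn /=; case: (c w) => /=.
  by rewrite !scale0r !addr0 sqn0 addr0.
by rewrite scale0r add0r sqn0 add0r.
Qed.

Let ihet : P.-integrable setT
  (EFin \o (fun w => G * (B * sqn (gF (xp w)) + zeta ^+ 2))).
Proof.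
apply: integrable_EFinZ; apply: integrable_EFinD.
  by apply: integrable_sqnZ; exact: L2_grad_next.
exact: finite_measure_integrable_cst.
Qed.

Let sum_het w : \sum_(i in Gs) sqn (gf i (xp w) - gF (xp w)) <=
  G * (B * sqn (gF (xp w)) + zeta ^+ 2).
Proof. by rewrite -ler_pdivrMl//; exact: gf_het. Qed.

Let Lhet i : i \in Gs -> L2 P (het i).
Proof.
move=> iG; apply: (L2_le _ ihet) => [|w].
  apply: measurable_rVZ.
    have mb : measurable_fun setT (fun b : bool => b%:R : R) by [].
    exact: (measurableT_comp mb mc).
  by apply: measurable_rVB; apply: measurableT_comp => //; exact: measurable_local_grad.
apply: le_trans (sum_het w); rewrite (bigD1 i)//= sqnZ.
apply: (@le_trans _ _ (sqn (gf i (xp w) - gF (xp w)))).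
  by case: (c w); rewrite ?expr1n ?expr0n ?mul1r ?mul0r ?sqn_ge0.
by rewrite lerDl; apply: sumr_ge0 => *; exact: sqn_ge0.
Qed.

(** x^(k+1) is a function of (x^k, g^k), hence independent of c_k; this is why heterogeneity is
    weighted by p. *)
Let sum_Esq_het : \sum_(i in Gs) Esq P (het i) <=
  p * (G * (B * Esq P (fun w => gF (xp w)) + zeta ^+ 2)).
Proof.
pose k (y : Rd * Rd) := G * (B * sqn (gF (y.1 - gamma *: y.2)) + zeta ^+ 2).
have mk : measurable_fun setT k.
  apply: measurable_funM => //; apply: measurable_funD => //.
  apply: measurable_funM => //; apply: measurable_sqn; apply: measurableT_comp => //.
  by apply: measurable_rVB => //; apply: measurable_rVZ.
have k0 y : 0 <= k y.
  apply: mulr_ge0 => //; apply: addr_ge0; last exact: sqr_ge0.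
  by apply: mulr_ge0 => //; exact: sqn_ge0.
have e := @coin_Rintegral (fun b => b%:R) k (fun b => ler0n _ _) k0 mk ihet.
have -> : p * (G * (B * Esq P (fun w => gF (xp w)) + zeta ^+ 2)) =
    \int[P]_w ((c w)%:R * k (Y w)).
  rewrite e /= mulr1 mulr0 addr0; congr (_ * _).
  have [_ i1] := L2_grad_next.
  rewrite /k/= RintegralZl//; last first.
    apply: integrable_EFinD; first exact: integrable_EFinZ.
    exact: finite_measure_integrable_cst.
  rewrite RintegralD//; last 2 first.
  - exact: integrable_EFinZ.
  - exact: finite_measure_integrable_cst.
  rewrite RintegralZl// Rintegral_cst//=.
  by rewrite probability_setT mulr1.
apply: sum_Esq_le => [i iG||w]; first exact: Lhet.
  apply: le_integrable ihet => //.
    apply/measurable_EFinP; apply: measurable_funM; last exact: (measurableT_comp mk).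
    have mb : measurable_fun setT (fun b : bool => b%:R : R) by [].
    exact: (measurableT_comp mb mc).
  move=> w _ /=; rewrite lee_fin normrM normr_nat -[leRHS]mul1r.
  by apply: ler_wpM2r => //; case: (c w).
rewrite /het; case: (c w); last first.
  by rewrite mul0r big1// => i _; rewrite scale0r sqn0.
by under eq_bigr do rewrite scale1r; rewrite mul1r; exact: sum_het.
Qed.

Let Ldev i : i \in Gs -> L2 P (dev i).
Proof.
move=> iG; have LG := L2_nn (L2B L2_grad_next Lgrad).
by have := L2B (Ldelta iG) LG; under eq_fun do rewrite -scalerBr.
Qed.

(** The increments average to that of [gF], so the centred sum of squares is the sum of squares
    minus G |D|^2, the very quantity that (A3) bounds. *)
Let sum_Esq_dev : \sum_(i in Gs) Esq P (dev i) <=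
  G * Lpm ^+ 2 * ((1 - p) * Esq P dx).
Proof.
rewrite -Esq_nn_dx; have [_ i1] := L2_nn Ldx; rewrite -RintegralZl//.
apply: sum_Esq_le => [i iG||w].
- exact: Ldev.
- by apply: integrable_sqnZ; exact: L2_nn.
rewrite /dev; under eq_bigr do rewrite sqn_nn.
rewrite -mulr_sumr sqn_nn mulrCA ler_wpM2l//.
set D := gF (xp w) - gF (x w).
have sD : \sum_(i in Gs) delta i (V1 w) = G *: D.
  by rewrite /delta/= sumrB /D !gFE -scalerBr scalerA mulfV ?gt_eqF// scale1r.
have -> : \sum_(i in Gs) sqn (delta i (V1 w) - D) =
    \sum_(i in Gs) sqn (delta i (V1 w)) - G * sqn D.
  under eq_bigr do rewrite sqnB.
  rewrite !big_split/= sumr_const sumrN -mulr_sumr -dot_suml sD dotZl -sqnE.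
  by rewrite -[sqn D *+ _]mulr_natl; ring.
have := gf_var (xp w) (x w); rewrite -/(dx w) -/D => h.
rewrite -mulrA -ler_pdivrMl//; apply: le_trans h.
by rewrite mulrBr mulrA mulVf ?gt_eqF// mul1r.
Qed.

Let Lmsg_ref i : i \in Gs -> L2 P (fun w => msg i w - ref w).
Proof.
move=> iG; under eq_fun do rewrite msg_ref.
by apply: L2D; [exact: Lhet|apply: L2D; [exact: Lerri|exact: Ldev]].
Qed.

Let Esq_msg_ref i : i \in Gs -> Esq P (fun w => msg i w - ref w) =
  Esq P (het i) + Esq P (fun w => err i (V3 i w)) + Esq P (dev i).
Proof.
move=> iG; have LL := L2D (Lerri iG) (Ldev iG).
have [_ i1] := Lhet iG; have [_ i2] := LL.
transitivity (Esq P (het i) + Esq P (fun w => err i (V3 i w) + dev i w)).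
  by rewrite -RintegralD//; apply: eq_Rintegral => w _; exact: sqn_msg_ref.
rewrite -addrA; congr (_ + _); rewrite EsqD//; [|exact: Lerri|exact: Ldev].
have ma : measurable_fun setT
    (fun v : T1 => nn v *: (delta i v - (gF (next v) - gF v.1.1))).
  apply: measurable_rVZ => //; apply: measurable_rVB; first exact: mdelta.
  by apply: measurable_rVB; exact: measurableT_comp.
have [_ _ ort] := orthogonality mV1 (@measurable_id _ T1 setT) fresh1 (fun=> erefl)
  iG (negbT (finset.in_set0 i)) (negbT (finset.in_set0 i)) ma (Ldev iG).
by rewrite EdotC ort mulr0 addr0.
Qed.

Let V := omega * (L ^+ 2 + Lpm ^+ 2) + (1 + omega) * lam.

Let sum_msg_pairs :
  \sum_(i in Gs) \sum_(l in Gs) Esq P (fun w => msg i w - msg l w) <=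
  2 * G ^+ 2 * (p * (B * Esq P (fun w => gF (xp w)) + zeta ^+ 2)
    + (1 - p) * (V + Lpm ^+ 2) * Esq P dx).
Proof.
have := sum_Esq_pairs Lmsg_ref.
rewrite (eq_bigr _ Esq_msg_ref) !big_split/=.
have -> : (\sum_(i in Gs) \sum_(l in Gs)
      Esq P (fun w => msg i w - ref w - (msg l w - ref w))) =
    \sum_(i in Gs) \sum_(l in Gs) Esq P (fun w => msg i w - msg l w).
  apply: eq_bigr => i _; apply: eq_bigr => l _; apply: eq_Rintegral => w _.
  by rewrite opprB addrA subrK.
move=> h; apply: le_trans h _.
rewrite expr2 !mulrA -[leRHS]mulrA ler_wpM2l// ?mulr_ge0 ?ler0n//.
have := sum_Esq_het; have := Esq_err_le; have := sum_Esq_dev; rewrite -/V; lra.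
Qed.

(** * Robust aggregation *)

Section aggregation.
Variables (cd : R) (xN gN : Omega -> Rd) (M : 'I_n -> Omega -> Rd).
Hypotheses (cd0 : 0 <= cd) (p_gt0 : 0 < p) (mgN : measurable_fun setT gN).
Hypothesis xNE : forall w, xN w = x w - gamma *: g w.
Hypothesis ME : forall i w, i \in Gs -> M i w = if c w then gf i (xN w)
  else g w + Q (Dhat i (xN w) (x w) (xi i w)) (eta i w).
Hypothesis robust : (\int[P]_w (sqn (gN w - G^-1 *: \sum_(i in Gs) M i w))%:E
  <= (cd / (G * (G - 1)))%:E
     * \sum_(i in Gs) \sum_(l in Gs) \int[P]_w (sqn (M i w - M l w))%:E)%E.

Let xNE' : xN = xp. Proof. by apply/funext => w; rewrite xNE. Qed.

Let ME' i : i \in Gs -> M i = msg i.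
Proof. by move=> iG; apply/funext => w; rewrite ME// xNE'. Qed.

Let Lmsg2 i l : i \in Gs -> l \in Gs -> L2 P (fun w => msg i w - msg l w).
Proof.
move=> iG lG; have := L2B (Lmsg_ref iG) (Lmsg_ref lG).
by under eq_fun do rewrite opprB addrA subrK.
Qed.

Let T := p * (B * Esq P (fun w => gF (xp w)) + zeta ^+ 2)
    + (1 - p) * (V + Lpm ^+ 2) * Esq P dx.

(** Byzantine messages come without moment bounds, so square-integrability of the aggregation error
    is itself drawn from (R). The 4 is 2 from the pairwise sum times G / (G - 1) <= 2, valid for G
    >= 2. *)
Let Lagg : L2 P (fun w => gN w - gbar w) /\
  Esq P (fun w => gN w - gbar w) <= 4 * cd * T.
Proof.
have gbarE' : (fun w => G^-1 *: \sum_(i in Gs) M i w) = gbar.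
  by apply/funext => w; rewrite /gbar; congr (_ *: _); apply: eq_bigr => i iG; rewrite ME'.
have G1 : 0 < G - 1 by rewrite subr_gt0 ltr1n.
have k0 : 0 <= cd / (G * (G - 1)) by rewrite divr_ge0// mulr_ge0// ltW.
have h : (\int[P]_w (sqn (gN w - gbar w))%:E <= (4 * cd * T)%:E)%E.
  have -> : (fun w => (sqn (gN w - gbar w))%:E) =
      (fun w => (sqn (gN w - G^-1 *: \sum_(i in Gs) M i w))%:E).
    by apply/funext => w; rewrite -gbarE'.
  apply: le_trans robust _.
  rewrite (eq_bigr (fun i =>
    (\sum_(l in Gs) Esq P (fun w => msg i w - msg l w))%:E)); last first.
    move=> i iG; rewrite -sumEFin; apply: eq_bigr => l lG.
    by rewrite (ME' iG) (ME' lG) L2_Esq//; exact: Lmsg2.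
  rewrite sumEFin -EFinM lee_fin.
  apply: le_trans (ler_wpM2l k0 sum_msg_pairs) _; rewrite -/T.
  (* The sign is inherited from the sum of squares that [T] dominates. *)
  have T0 : 0 <= T.
    have : 0 <= 2 * G ^+ 2 * T.
      apply: le_trans sum_msg_pairs; apply: sumr_ge0 => i _; apply: sumr_ge0 => l _.
      exact: Esq_ge0.
    by rewrite pmulr_rge0// mulr_gt0// exprn_gt0.
  have -> : cd / (G * (G - 1)) * (2 * G ^+ 2 * T) = (2 * cd * T) * (G / (G - 1)).
    by field; rewrite !gt_eqF.
  have -> : 4 * cd * T = (2 * cd * T) * 2 by ring.
  apply: ler_wpM2l; first by rewrite mulr_ge0// mulr_ge0.
  rewrite ler_pdivrMr// mulrBr mulr1 mulr_natl mulr2n -addrA lerDl subr_ge0.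
  by rewrite ler_nat.
have mgbar : measurable_fun setT gbar.
  rewrite -gbarE'; apply: measurable_rVZ => //.
  apply: measurable_rV_sum => i iG; rewrite ME'//.
  have := measurable_rVD (Lmsg_ref iG).1 (_ : measurable_fun setT ref).
  under eq_fun do rewrite subrK; apply.
  apply: measurable_fun_ifT => //; first exact: measurableT_comp.
  by apply: measurable_rVD => //; apply: measurable_rVB; exact: measurableT_comp.
have Lag : L2 P (fun w => gN w - gbar w).
  by apply: L2_lty; [exact: measurable_rVB|exact: le_lt_trans h (ltry _)].
by split=> //; rewrite -lee_fin -L2_Esq.
Qed.

(** Square-integrability at the next iterate is returned with the estimates, so that the invariant
    can be carried to the next round. *)
Lemma round_estimate :
  [/\ L2 P (fun w => gF (xN w)), L2 P (fun w => gN w - gF (xN w)),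
    Esq P (fun w => gF (xN w)) <=
      2 * Esq P (fun w => gF (x w)) + 2 * L ^+ 2 * Esq P (fun w => xN w - x w) &
    Esq P (fun w => gN w - gF (xN w)) <=
      (1 + p / 2) * ((1 - p) * Esq P (fun w => g w - gF (x w)) +
       (1 - p) * V / G * Esq P (fun w => xN w - x w)) +
      (1 + (p / 2)^-1) * (4 * cd * (p * (B * Esq P (fun w => gF (xN w)) + zeta ^+ 2)
         + (1 - p) * (V + Lpm ^+ 2) * Esq P (fun w => xN w - x w)))].
Proof.
rewrite xNE'; have [L1 E1] := Esq_gbar; have [L2' E2] := Lagg.
have p2 : 0 < p / 2 by rewrite divr_gt0.
have sE w : gN w - gF (xp w) = (gbar w - gF (xp w)) + (gN w - gbar w).
  by rewrite [RHS]addrC addrA subrK.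
have LN : L2 P (fun w => gN w - gF (xp w)).
  by under eq_fun do rewrite sE; exact: L2D.
split => //; [exact: L2_grad_next|exact: Esq_grad_next|].
have [_ i1] := L1; have [_ i2] := L2'; have [_ iN] := LN.
apply: (@le_trans _ _ ((1 + p / 2) * Esq P (fun w => gbar w - gF (xp w)) +
   (1 + (p / 2)^-1) * Esq P (fun w => gN w - gbar w))).
  rewrite -!RintegralZl// -RintegralD//; [|exact: integrable_EFinZ..].
  apply: le_Rintegral => //.
    by apply: integrable_EFinD; exact: integrable_EFinZ.
  by move=> w _; rewrite sE; exact: sqnD_young.
by apply: lerD; apply: ler_wpM2l => //; rewrite addr_ge0// ?invr_ge0 ltW.
Qed.
End aggregation.

End round.

(** * Adaptedness of the iterates *)

(** Regards [F] as the sigma-algebra of a measurable space, so that adaptedness obeys the ordinary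
    calculus of measurable maps. *)
Lemma FmeasP {dO} {Omega : measurableType dO} {dT} {T : measurableType dT}
  (F : set (set Omega)) (X : Omega -> T) : sigma_algebra setT F ->
  Fmeas F X <-> measurable_fun setT (X : g_sigma_algebraType F -> T).
Proof.
move=> sF; split=> [FX _ Y mY|mX Y mY].
  by rewrite setTI; apply: sub_sigma_algebra; exact: FX.
by have := mX measurableT _ mY; rewrite setTI measurable_g_measurableTypeE.
Qed.

Lemma Fmeas_sub {dO} {Omega : measurableType dO} {dT} {T : measurableType dT}
  (F F' : set (set Omega)) (X : Omega -> T) : F `<=` F' -> Fmeas F X -> Fmeas F' X.
Proof. by move=> FF' FX B mB; apply: FF'; exact: FX. Qed.

Lemma Fmeas_measurable {dO} {Omega : measurableType dO} {dT} {T : measurableType dT}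
  (F : set (set Omega)) (X : Omega -> T) : sub_sigma F -> Fmeas F X ->
  measurable_fun setT X.
Proof. by move=> [_ Fm] FX _ Y mY; rewrite setTI; apply: Fm; exact: FX. Qed.

Section state_measurability.
Context {R : realType} {d n : nat} {dO : measure_display} {Omega : measurableType dO}.
Context {dS} {S : measurableType dS} {dQ} {SQ : measurableType dQ}.
Local Notation Rd := 'rV[R]_d.
Variables (Gs : {set 'I_n}) (gradfi : 'I_n -> Rd -> Rd)
  (Dhat : 'I_n -> Rd -> Rd -> S -> Rd) (Q : Rd -> SQ -> Rd)
  (agg : n.-tuple Rd -> Rd) (gamma : R).
Hypothesis mgradfi : forall i, i \in Gs -> measurable_fun setT (gradfi i).
Hypothesis mDhat : forall i, i \in Gs ->
  measurable_fun setT (fun z : (Rd * Rd) * S => Dhat i z.1.1 z.1.2 z.2).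
Hypothesis mQ : measurable_fun setT (fun z : Rd * SQ => Q z.1 z.2).
Hypothesis magg : measurable_fun setT agg.

(** The sample space is a parameter, which allows the lemma to be instantiated with the
    sigma-algebra [F k.+1] instead of the full one. *)
Lemma measurable_round (c : Omega -> bool) (xi : 'I_n -> Omega -> S)
  (eta : 'I_n -> Omega -> SQ) (gB : 'I_n -> Omega -> Rd) (xk gk : Omega -> Rd) :
  measurable_fun setT c ->
  (forall i, i \in Gs -> measurable_fun setT (xi i) /\ measurable_fun setT (eta i)) ->
  (forall i, i \notin Gs -> measurable_fun setT (gB i)) ->
  measurable_fun setT xk -> measurable_fun setT gk ->
  measurable_fun setT (fun w => agg [tuple
    (if i \in Gs then
      (if c w then gradfi i (xk w - gamma *: gk w)
       else gk w + Q (Dhat i (xk w - gamma *: gk w) (xk w) (xi i w)) (eta i w))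
     else gB i w) | i < n]).
Proof.
move=> mc ms mB mx mg; apply: measurableT_comp => //.
have mx' : measurable_fun setT (fun w => xk w - gamma *: gk w).
  by apply: measurable_rVB => //; exact: measurable_rVZ.
apply/measurable_fun_tnthP => i.
rewrite (_ : _ \o _ = fun w => if i \in Gs then
      (if c w then gradfi i (xk w - gamma *: gk w)
       else gk w + Q (Dhat i (xk w - gamma *: gk w) (xk w) (xi i w)) (eta i w))
     else gB i w); last by apply/funext => w /=; rewrite tnth_mktuple.
have [iG|iG] := boolP (i \in Gs); last exact: mB.
have [mxi meta] := ms i iG.
apply: measurable_fun_ifT => //.
  by apply: measurableT_comp => //; exact: mgradfi.
apply: measurable_rVD => //.
have mD : measurable_fun setT
    (fun w => Dhat i (xk w - gamma *: gk w) (xk w) (xi i w)).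
  have -> : (fun w => Dhat i (xk w - gamma *: gk w) (xk w) (xi i w)) =
    (fun z : (Rd * Rd) * S => Dhat i z.1.1 z.1.2 z.2) \o
    (fun w => ((xk w - gamma *: gk w, xk w), xi i w)) by [].
  apply: measurableT_comp; first exact: mDhat.
  by apply: measurable_fun_pair => //; exact: measurable_fun_pair.
have -> : (fun w => Q (Dhat i (xk w - gamma *: gk w) (xk w) (xi i w)) (eta i w)) =
  (fun z : Rd * SQ => Q z.1 z.2) \o
  (fun w => (Dhat i (xk w - gamma *: gk w) (xk w) (xi i w), eta i w)) by [].
by apply: measurableT_comp => //; exact: measurable_fun_pair.
Qed.

End state_measurability.

Section state_adapted.
Context {R : realType} {d n : nat} {dO : measure_display} {Omega : measurableType dO}.
Context {dS} {S : measurableType dS} {dQ} {SQ : measurableType dQ}.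
Local Notation Rd := 'rV[R]_d.
Variables (Gs : {set 'I_n}) (gradfi : 'I_n -> Rd -> Rd)
  (Dhat : 'I_n -> Rd -> Rd -> S -> Rd) (Q : Rd -> SQ -> Rd)
  (agg : n.-tuple Rd -> Rd) (gamma : R) (x0 : Rd) (g0 : Omega -> Rd)
  (c : nat -> Omega -> bool) (xi : nat -> 'I_n -> Omega -> S)
  (eta : nat -> 'I_n -> Omega -> SQ) (gB : nat -> 'I_n -> Omega -> Rd)
  (F : nat -> set (set Omega)).
Hypothesis mgradfi : forall i, i \in Gs -> measurable_fun setT (gradfi i).
Hypothesis mDhat : forall i, i \in Gs ->
  measurable_fun setT (fun z : (Rd * Rd) * S => Dhat i z.1.1 z.1.2 z.2).
Hypothesis mQ : measurable_fun setT (fun z : Rd * SQ => Q z.1 z.2).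
Hypothesis magg : measurable_fun setT agg.
Hypothesis sF : forall k, sub_sigma (F k).
Hypothesis FS : forall k, F k `<=` F k.+1.
Hypothesis Fg0 : Fmeas (F 0) g0.
Hypothesis Fc : forall k, Fmeas (F k.+1) (c k).
Hypothesis Fs : forall k i, i \in Gs -> Fmeas (F k.+1) (xi k i) /\ Fmeas (F k.+1) (eta k i).
Hypothesis FB : forall k i, i \notin Gs -> Fmeas (F k.+1) (gB k.+1 i).

Let X := iter_x Gs gradfi Dhat Q agg gamma x0 g0 c xi eta gB.
Let Gv := iter_g Gs gradfi Dhat Q agg gamma x0 g0 c xi eta gB.

Lemma iter_adapted k : Fmeas (F k) (fun w => (X k w, Gv k w)).
Proof.
elim: k => [|k ih].
  apply/FmeasP; first by have [] := sF 0.
  apply: measurable_fun_pair; first exact: measurable_cst.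
  by apply/FmeasP => //; have [] := sF 0.
have sk : sigma_algebra setT (F k.+1) by have [] := sF k.+1.
have /(FmeasP _ sk)/measurable_fun_pairP[mX mG] := Fmeas_sub (@FS k) ih.
apply/FmeasP => //; apply: measurable_fun_pair.
  by apply: measurable_rVB => //; exact: measurable_rVZ.
apply: (@measurable_round _ _ _ _ (g_sigma_algebraType (F k.+1)) _ _ _ _ Gs gradfi
  Dhat Q agg gamma mgradfi mDhat mQ magg (c k) (xi k) (eta k) (gB k.+1) (X k) (Gv k)) => //.
- by apply/FmeasP.
- by move=> i iG; have [h1 h2] := Fs k iG; split; apply/FmeasP.
- by move=> i iG; apply/FmeasP => //; exact: FB.
Qed.

End state_adapted.

(** * Lyapunov recursion *)

(** After multiplication by gamma, with u = gamma L and v = gamma sqrt A, the claim is u + v^2 <= 1;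
    it follows from u + v <= 1, as v lies in [0,1]. *)
Lemma stepsize_ge0 (R : rcfType) (L A gamma : R) : 0 <= L -> 0 <= A -> 0 < gamma ->
  gamma <= 1 / (L + Num.sqrt A) -> 0 <= gamma^-1 - L - gamma * A.
Proof.
move=> L0 A0 g0 hg; have s0 := sqrtr_ge0 A.
(* If the sum were 0, then 1 / 0 = 0 would contradict 0 < gamma <= 1 / 0. *)
have Ls : 0 < L + Num.sqrt A.
  rewrite lt0r addr_ge0// andbT; apply/eqP => e.
  by move: (lt_le_trans g0 hg); rewrite e invr0 mulr0 ltxx.
have h1 : gamma * (L + Num.sqrt A) <= 1 by rewrite -ler_pdivlMr.
rewrite -(pmulr_rge0 _ g0).
have -> : gamma * (gamma^-1 - L - gamma * A) =
  1 - gamma * L - (gamma * Num.sqrt A) ^+ 2.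
  by rewrite exprMn sqr_sqrtr//; field; rewrite gt_eqF.
rewrite mulrDr in h1.
have gL : 0 <= gamma * L by rewrite mulr_ge0// ltW.
have gs : 0 <= gamma * Num.sqrt A by rewrite mulr_ge0// ltW.
move: (gamma * L) (gamma * Num.sqrt A) gL gs h1 => u v u0 v0 uv; nra.
Qed.

(* The last hypothesis is the form in which the stepsize condition enters; [A] is chosen
   so that the remaining coefficient of [D] is exactly half of it. *)
Lemma lyapunov_step (R : realFieldType)
  (F F' N N' D e e' gamma p c delta B zeta L Lpm lam omega G V A : R) :
  0 < gamma -> 0 < p -> p <= 1 -> 0 < c -> 0 <= delta -> 0 <= B -> 0 < G ->
  0 <= V -> 0 <= D -> 0 <= e -> 0 <= N' ->
  V = omega * (L ^+ 2 + Lpm ^+ 2) + (1 + omega) * lam ->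
  A = 48 * B * L ^+ 2 * c * delta / p
    + 6 * (1 - p) / p * (4 * c * delta / p + 1 / (2 * G))
        * (omega * L ^+ 2 + (1 + omega) * lam)
    + 6 * (1 - p) / p * (4 * c * delta * (1 + omega) / p + omega / (2 * G))
        * Lpm ^+ 2 ->
  F' <= F - gamma / 2 * N - ((2 * gamma)^-1 - L / 2) * D + gamma / 2 * e ->
  e' <= (1 + p / 2) * ((1 - p) * e + (1 - p) * V / G * D) +
    (1 + (p / 2)^-1) * (4 * (c * delta) *
      (p * (B * N' + zeta ^+ 2) + (1 - p) * (V + Lpm ^+ 2) * D)) ->
  N' <= 2 * N + 2 * L ^+ 2 * D ->
  0 <= (gamma^-1 - L - gamma * A) * D ->
  F' + gamma / p * e' <= F + gamma / p * e
    - gamma / 2 * (1 - 48 * B * c * delta / p) * N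
    + 12 * gamma * c * delta * zeta ^+ 2 / p.
Proof.
move=> g0 p0 p1 c0 d0 B0 G0 V0 D0 e0 N'0 VE AE hF he hN hD.
have q0 : 0 <= 1 - p by rewrite subr_ge0.
have cd0 : 0 <= c * delta by rewrite mulr_ge0// ltW.
have VD0 : 0 <= (1 - p) * V / G * D.
  by rewrite mulr_ge0// mulr_ge0 ?invr_ge0 ?(ltW G0)// mulr_ge0.
have z0 : 0 <= zeta ^+ 2 by rewrite sqr_ge0.
have l0 : 0 <= Lpm ^+ 2 by rewrite sqr_ge0.
have VL0 : 0 <= (1 - p) * (V + Lpm ^+ 2) * D by rewrite !mulr_ge0// addr_ge0.
have T0 : 0 <= 4 * (c * delta) * (p * (B * N' + zeta ^+ 2) + (1 - p) * (V + Lpm ^+ 2) * D).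
  apply: mulr_ge0; first exact: mulr_ge0.
  apply: addr_ge0 => //; apply: mulr_ge0; first exact: ltW.
  by apply: addr_ge0 => //; exact: mulr_ge0.
(* (1 + p/2)(1 - p) = 1 - p/2 - p^2/2. After scaling by gamma / p, the gain p/2 cancels the term
   gamma/2 e of the descent inequality. *)
have h1 : (1 + p / 2) * ((1 - p) * e) <= (1 - p / 2) * e.
  rewrite mulrA; apply: ler_wpM2r => //; nra.
have h2 : (1 + p / 2) * ((1 - p) * V / G * D) <= 3 / 2 * ((1 - p) * V / G * D).
  by apply: ler_wpM2r => //; lra.
have h3 : 1 + (p / 2)^-1 <= 3 / p.
  rewrite -(ler_pM2r p0) mulrDl mulfVK ?gt_eqF// invf_div mulfVK ?gt_eqF//; lra.
have h4 := ler_wpM2r T0 h3.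
have h5 : 4 * (c * delta) * (p * (B * N' + zeta ^+ 2) + (1 - p) * (V + Lpm ^+ 2) * D) <=
  4 * (c * delta) * (p * (B * (2 * N + 2 * L ^+ 2 * D) + zeta ^+ 2)
     + (1 - p) * (V + Lpm ^+ 2) * D).
  apply: ler_wpM2l; first by rewrite mulr_ge0.
  rewrite lerD2r; apply: ler_wpM2l; first exact: ltW.
  by rewrite lerD2r; apply: ler_wpM2l.
have p3 : 0 <= 3 / p by rewrite divr_ge0// ltW.
have h6 := ler_wpM2l p3 h5.
have gp : 0 <= gamma / p by rewrite divr_ge0// ltW.
have h7 : e' <= (1 - p / 2) * e + 3 / 2 * ((1 - p) * V / G * D) +
  3 / p * (4 * (c * delta) * (p * (B * (2 * N + 2 * L ^+ 2 * D) + zeta ^+ 2)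
     + (1 - p) * (V + Lpm ^+ 2) * D)).
  apply: le_trans he _; rewrite mulrDr; apply: lerD; first exact: lerD.
  exact: le_trans h4 h6.
have h8 := ler_wpM2l gp h7.
apply: le_trans (lerD hF h8) _.
rewrite -subr_ge0.
(* The terms in e and zeta cancel, and those in N cancel because (gamma / p)(3 / p) 4 c delta p 2 B
   = (gamma / 2) 48 B c delta / p. Only the multiple of D is left. *)
rewrite (_ : _ - _ = (gamma^-1 - L - gamma * A) * D / 2); first by rewrite divr_ge0.
by rewrite AE VE; field; rewrite !gt_eqF.
Qed.

(** * Descent and the random index *)

Section descent.
Context {R : realType} {d : nat} {dO : measure_display} {Omega : measurableType dO}.
Variable P : probability Omega R.
Local Notation Rd := 'rV[R]_d.
Variables (f : Rd -> R) (fstar L gamma : R) (x g : Omega -> Rd).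
Hypotheses (gamma0 : 0 < gamma) (df : forall y, differentiable f y).
Hypothesis f_smooth :
  forall y z, enorm (grad f y - grad f z) <= L * enorm (y - z).
Hypothesis f_ge : forall y, fstar <= f y.
Hypotheses (mx : measurable_fun setT x) (mg : measurable_fun setT g).
Hypothesis fi : P.-integrable setT (EFin \o (fun w => f (x w) - fstar)).
Hypothesis Lgrad : L2 P (fun w => grad f (x w)).
Hypothesis Lerr : L2 P (fun w => g w - grad f (x w)).

Let dx w := x w - gamma *: g w - x w.

Let dxE w : dx w = (- gamma) *: g w.
Proof. by rewrite /dx addrAC subrr add0r scaleNr. Qed.

Let Ldx : L2 P dx.
Proof.
have := L2Z (- gamma) (L2D Lerr Lgrad).
by under eq_fun do rewrite subrK -dxE.
Qed.

Let bound w := (f (x w) - fstar) + (- (gamma / 2) * sqn (grad f (x w)) +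
  (- ((2 * gamma)^-1 - L / 2) * sqn (dx w) + gamma / 2 * sqn (g w - grad f (x w)))).

Let ibound : P.-integrable setT (EFin \o bound).
Proof.
apply: integrable_EFinD => //; apply: integrable_EFinD; first exact: integrable_sqnZ.
by apply: integrable_EFinD; exact: integrable_sqnZ.
Qed.

(** Polarization turns -gamma <grad f, g> into -gamma/2 (|grad f|^2 + |g|^2 - |g - grad f|^2), and
    gamma/2 |g|^2 is |dx|^2 / (2 gamma). *)
Let descent_pointwise w : f (x w - gamma *: g w) - fstar <= bound w.
Proof.
have := smooth_descent (x w) (dx w) df f_smooth.
rewrite {1}/dx addrC subrK /bound dxE dotZr !sqnZ sqnB (dotC (g w)).
move: (dot _ _) (sqn (g w)) (sqn (grad f (x w))) => a b c h.
rewrite lerBlDr; apply: le_trans h _; rewrite le_eqVlt; apply/orP; left; apply/eqP.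
by field; rewrite gt_eqF.
Qed.

Lemma descent_integrable :
  P.-integrable setT (EFin \o (fun w => f (x w - gamma *: g w) - fstar)).
Proof.
apply: le_integrable ibound => //.
  apply/measurable_EFinP; apply: measurable_funB => //; apply: measurableT_comp.
    exact: differentiable_measurable.
  by apply: measurable_rVB => //; exact: measurable_rVZ.
move=> w _ /=; rewrite lee_fin ger0_norm ?subr_ge0//.
exact: le_trans (descent_pointwise w) (ler_norm _).
Qed.

Lemma descent_expectation : \int[P]_w (f (x w - gamma *: g w) - fstar) <=
  \int[P]_w (f (x w) - fstar) - gamma / 2 * Esq P (fun w => grad f (x w))
  - ((2 * gamma)^-1 - L / 2) * Esq P (fun w => x w - gamma *: g w - x w)
  + gamma / 2 * Esq P (fun w => g w - grad f (x w)).
Proof.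
have [_ i1] := Lgrad; have [_ i2] := Lerr; have [_ i3] := Ldx.
apply: (@le_trans _ _ (\int[P]_w bound w)).
  apply: le_Rintegral => //; exact: descent_integrable.
rewrite /bound RintegralD//; last first.
  apply: integrable_EFinD; first exact: integrable_sqnZ.
  by apply: integrable_EFinD; exact: integrable_sqnZ.
rewrite [X in _ + X <= _]RintegralD//; last 2 first.
- exact: integrable_EFinZ.
- by apply: integrable_EFinD; exact: integrable_EFinZ.
rewrite [X in _ + (_ + X) <= _]RintegralD//; [|exact: integrable_EFinZ..].
by rewrite !RintegralZl// !mulNr !addrA.
Qed.

End descent.

(** * The random output index *)

Section random_index.
Context {R : realType} {dO : measure_display} {Omega : measurableType dO}.
Variable P : probability Omega R.
Local Open Scope ereal_scope.

Lemma indep_event_integral {dT} {T : measurableType dT} (V : Omega -> T)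
  (c : Omega -> bool) (p : R) (h : T -> R) : measurable_fun setT V ->
  measurable_fun setT c -> (0 <= p <= 1)%R ->
  indep_event P V (c @^-1` [set true]) p%:E ->
  measurable_fun setT h -> (forall t, (0 <= h t)%R) ->
  \int[P]_w ((c w)%:R * h (V w))%:E = p%:E * \int[P]_w (h (V w))%:E.
Proof.
move=> mV mc p01 Vt mh h0; have ind := indep_law_bool mV mc p01 Vt.
pose k (z : T * bool) := ((z.2)%:R * h z.1)%:E.
have mk : measurable_fun setT k.
  apply/measurable_EFinP; apply: measurable_funM; last exact: measurableT_comp.
  have mb : measurable_fun setT (fun b : bool => b%:R : R) by [].
  exact: (measurableT_comp mb measurable_snd).
have k0 z : 0 <= k z by rewrite lee_fin mulr_ge0.
rewrite (ge0_indep_law_integral mV mc ind mk k0).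
rewrite -ge0_integralZl_EFin//; last 3 first.
- by move=> w _; rewrite lee_fin.
- by apply/measurable_EFinP; exact: measurableT_comp.
- by case/andP : p01.
apply: eq_integral => w _; rewrite integral_bernoulli_prob//.
by rewrite /k/= mul1r mul0r mule0 adde0.
Qed.

Import HBNNSimple.

(* [f] need not be measurable: [kappa] is arbitrary on the null event [kappa > K]. *)
Lemma ge0_le_integral_dominated (f h : Omega -> \bar R) (N : set Omega) :
  (forall w, 0 <= f w) -> (forall w, 0 <= h w) -> measurable_fun setT h ->
  measurable N -> P N = 0 -> (forall w, ~ N w -> f w <= h w) ->
  \int[P]_w f w <= \int[P]_w h w.
Proof.
move=> f0 h0 mh mN PN fh; rewrite ge0_integralTE//.
apply: ge_ereal_sup => _ /= [s sf <-]; rewrite -integralT_nnsfun.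
apply: ae_ge0_le_integral => //.
- by move=> w _; rewrite lee_fin.
- by apply/measurable_EFinP.
exists N; split => // w /= nle; apply: contrapT => nN; apply: nle => _.
exact: le_trans (sf w) (fh w nN).
Qed.

Lemma measurable_fun_eq_nat (kappa : Omega -> nat) (k : nat) :
  measurable [set w | kappa w = k] -> measurable_fun setT (fun w => kappa w == k).
Proof.
move=> mk; apply: (measurable_fun_bool true); rewrite setTI.
suff -> : (fun w => kappa w == k) @^-1` [set true] = [set w | kappa w = k] by [].
by apply/seteqP; split => w /= /eqP.
Qed.

(** The events [kappa = k], k <= K, are disjoint of total mass 1, so their complement is null;
    outside it the summand with k = kappa alone reproduces the left integrand. *)
Lemma random_index_integral (K : nat) (kappa : Omega -> nat) (h : nat -> Omega -> R) :
  (forall k, (k <= K)%N -> measurable [set w | kappa w = k]) ->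
  (forall k, (k <= K)%N -> P [set w | kappa w = k] = ((K.+1)%:R^-1)%:E) ->
  (forall k, measurable_fun setT (h k)) -> (forall k w, (0 <= h k w)%R) ->
  \int[P]_w (h (kappa w) w)%:E <=
  \sum_(k < K.+1) \int[P]_w ((kappa w == k :> nat)%:R * h k w)%:E.
Proof.
move=> mk Pk mh h0.
pose E (k : 'I_K.+1) := [set w | kappa w = k].
have mE k : measurable (E k) by apply: mk; rewrite -ltnS.
pose N := ~` \big[setU/set0]_(k < K.+1) E k.
have mU : measurable (\big[setU/set0]_(k < K.+1) E k).
  by apply: bigsetU_measurable => k _; exact: mE.
have PN : P N = 0.
  rewrite probability_setC// measure_bigsetU_ord//.
    rewrite (eq_bigr (fun=> ((K.+1)%:R^-1)%:E)); last first.
      by move=> k _; apply: Pk; rewrite -ltnS.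
    rewrite sumEFin sumr_const card_ord -[X in (1 - X%:E)]mulr_natl mulfV//.
    by rewrite subee.
  move=> i j _ _ [w []]; rewrite /E/= => ei ej.
  by apply: val_inj; rewrite /= -ei -ej.
have mc (k : 'I_K.+1) :
    measurable_fun setT (fun w => ((kappa w == k :> nat)%:R * h k w)%R).
  apply: measurable_funM => //.
  have mb : measurable_fun setT (fun b : bool => b%:R : R) by [].
  apply: (measurableT_comp mb); apply: measurable_fun_eq_nat.
  by apply: mk; rewrite -ltnS.
rewrite -ge0_integral_sum_in; last 2 first.
- by move=> k _; apply/measurable_EFinP; exact: mc.
- by move=> k w _; rewrite lee_fin mulr_ge0.
apply: (@ge0_le_integral_dominated _ _ N) => //.
- by move=> w; rewrite lee_fin.
- by move=> w; apply: sume_ge0 => k _; rewrite lee_fin mulr_ge0.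
- by apply: emeasurable_sum => k; apply/measurable_EFinP; exact: mc.
- exact: measurableC.
move=> w; rewrite /N/= => /contrapT; rewrite -bigcup_seq/= => -[k _ /= kw].
rewrite (bigD1 k)//= kw eqxx mul1r leeDl// sume_ge0// => j _.
by rewrite lee_fin mulr_ge0.
Qed.

End random_index.

Lemma telescope_sum (R : realFieldType) (U N : nat -> R) (b C : R) :
  (forall k, U k.+1 <= U k - b * N k + C) ->
  forall k, b * (\sum_(i < k) N i) <= U 0%N - U k + k%:R * C.
Proof.
move=> h; elim=> [|k ih]; first by rewrite big_ord0 mulr0 mul0r addr0 subrr.
by rewrite big_ord_recr/= mulrDr mulrSr; have := h k; lra.
Qed.

(** Used with n = K + 1, beta = 48 B c delta and z = c delta zeta^2. Dividing by n (gamma / 2)(1 -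
    beta / p), positive since beta < p, turns 12 gamma z / p into 24 z / (p - beta). *)
Lemma telescope_rate (R : realFieldType) (p gamma beta z Phi S n : R) :
  0 < p -> 0 < gamma -> beta < p -> 0 < n ->
  gamma / 2 * (1 - beta / p) * S <= Phi + n * (12 * gamma * z / p) ->
  n^-1 * S <= 2 / (gamma * (1 - beta / p) * n) * Phi + 24 * z / (p - beta).
Proof.
move=> p0 g0 bp n0 h.
have q0 : 0 < p - beta by rewrite subr_gt0.
have k0 : 0 < n * (gamma / 2 * (1 - beta / p)).
  rewrite !mulr_gt0// subr_gt0 ltr_pdivrMr// mul1r//.
rewrite -(ler_pM2l k0).
have -> : n * (gamma / 2 * (1 - beta / p)) * (n^-1 * S) =
  gamma / 2 * (1 - beta / p) * S by field; rewrite !gt_eqF.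
apply: le_trans h _; rewrite le_eqVlt; apply/orP; left; apply/eqP.
by field; rewrite !gt_eqF.
Qed.

(** * Assembling the rate *)

Unset Implicit Arguments.

Theorem theorem1
  (R : realType) (d n m : nat) (Gs : {set 'I_n}) (delta : R)
  (fij : 'I_n -> 'I_m -> 'rV[R]_d -> R)
  (L B zeta Lpm Lcal omega cR p gamma : R) (b : nat)
  (dO : measure_display) (Omega : measurableType dO) (P : probability Omega R)
  (dS : measure_display) (S : measurableType dS) (nu : 'I_n -> probability S R)
  (dQ : measure_display) (SQ : measurableType dQ) (nuQ : probability SQ R)
  (Dhat : 'I_n -> 'rV[R]_d -> 'rV[R]_d -> S -> 'rV[R]_d)
  (Q : 'rV[R]_d -> SQ -> 'rV[R]_d)
  (agg : n.-tuple 'rV[R]_d -> 'rV[R]_d)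
  (x0 : 'rV[R]_d) (g0 : Omega -> 'rV[R]_d)
  (coin : nat -> Omega -> bool) (xi : nat -> 'I_n -> Omega -> S)
  (eta : nat -> 'I_n -> Omega -> SQ) (gB : nat -> 'I_n -> Omega -> 'rV[R]_d)
  (F : nat -> set (set Omega)) :
  let G := #|Gs| in
  let fi := loc_f fij in
  let f := glob_f Gs fij in
  let fstar := inf (range f) in
  let gradfi := fun i => grad (fi i) in
  let X := iter_x Gs gradfi Dhat Q agg gamma x0 g0 coin xi eta gB in
  let Gv := iter_g Gs gradfi Dhat Q agg gamma x0 g0 coin xi eta gB in
  let Msg := msg Gs gradfi Dhat Q agg gamma x0 g0 coin xi eta gB in
  let A := 48 * B * L ^+ 2 * cR * delta / p
         + 6 * (1 - p) / p * (4 * cR * delta / p + 1 / (2 * G%:R))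
             * (omega * L ^+ 2 + (1 + omega) * Lcal ^+ 2 / b%:R)
         + 6 * (1 - p) / p * (4 * cR * delta * (1 + omega) / p + omega / (2 * G%:R))
             * Lpm ^+ 2 in
  let Phi0 := fun w => f x0 - fstar + gamma / p * sqn (g0 w - grad f x0) in
  (* workers *)
  (2 <= G)%N ->
  0 <= delta -> delta < 1 / 2 ->
  #|~: Gs|%:R <= delta * n%:R ->
  (0 < m)%N ->
  (forall i j x, i \in Gs -> differentiable (fij i j) x) ->
  (* (A1) *)
  (forall x y, enorm (grad f x - grad f y) <= L * enorm (x - y)) ->
  has_lbound (range f) ->
  (* (A2) *)
  0 <= B -> 0 <= zeta ->
  (forall x, G%:R^-1 * \sum_(i in Gs) sqn (gradfi i x - grad f x)
             <= B * sqn (grad f x) + zeta ^+ 2) ->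
  (* (A3) *)
  0 <= Lpm ->
  (forall x y, G%:R^-1 * \sum_(i in Gs) sqn (gradfi i x - gradfi i y)
               - sqn (grad f x - grad f y) <= Lpm ^+ 2 * sqn (x - y)) ->
  (* (A4) : Dhat i x y s, s ~ nu i, is the random estimator of Delta_i(x,y) *)
  (0 < b)%N -> 0 <= Lcal ->
  (forall i, i \in Gs ->
     measurable_fun setT (fun z : ('rV[R]_d * 'rV[R]_d) * S => Dhat i z.1.1 z.1.2 z.2)) ->
  (forall i x y (j : 'I_d), i \in Gs ->
     (nu i).-integrable setT (fun s => (Dhat i x y s 0 j)%:E) /\
     (\int[nu i]_s (Dhat i x y s 0 j)%:E = ((gradfi i x - gradfi i y) 0 j)%:E)%E) ->
  (forall x y,
     ((G%:R^-1)%:E * \sum_(i in Gs)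
        \int[nu i]_s (sqn (Dhat i x y s - (gradfi i x - gradfi i y)))%:E
      <= (Lcal ^+ 2 / b%:R * sqn (x - y))%:E)%E) ->
  (* compressor : Q x s, s ~ nuQ *)
  0 <= omega ->
  measurable_fun setT (fun z : 'rV[R]_d * SQ => Q z.1 z.2) ->
  (forall x (j : 'I_d),
     nuQ.-integrable setT (fun s => (Q x s 0 j)%:E) /\
     (\int[nuQ]_s (Q x s 0 j)%:E = (x 0 j)%:E)%E) ->
  (forall x, (\int[nuQ]_s (sqn (Q x s - x))%:E <= (omega * sqn x)%:E)%E) ->
  (* aggregator is a measurable map *)
  measurable_fun setT agg ->
  (* filtration: F k = information available at the start of round k *)
  (forall k, sub_sigma (F k)) ->
  (forall k, F k `<=` F k.+1) ->
  Fmeas (F 0) g0 ->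
  (forall k, Fmeas (F k.+1) (coin k)) ->
  (forall k i, i \in Gs -> Fmeas (F k.+1) (xi k i) /\ Fmeas (F k.+1) (eta k i)) ->
  (forall k i, i \notin Gs -> Fmeas (F k.+1) (gB k.+1 i)) ->
  (* fresh randomness of round k: c_k ~ Bernoulli(p) independent of the past,
     and the seeds of the good workers independent of (past, c_k) and of each
     other, with laws nu i and nuQ *)
  (forall k (Aev : set Omega) (bb : bool) (Bs : 'I_n -> set S) (Cs : 'I_n -> set SQ),
     F k Aev -> (forall i, measurable (Bs i)) -> (forall i, measurable (Cs i)) ->
     P (Aev `&` (coin k @^-1` [set bb])
            `&` \bigcap_(i in [set i | i \in Gs]) ((xi k i @^-1` Bs i) `&` (eta k i @^-1` Cs i)))
     = (P Aev * (if bb then p else 1 - p)%:E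
          * \big[*%E/1%E]_(i in Gs) (nu i (Bs i) * nuQ (Cs i)))%E) ->
  (* robustness property (R) *)
  (forall k,
     (\int[P]_w (sqn (Gv k.+1 w - G%:R^-1 *: \sum_(i in Gs) Msg k i w))%:E
      <= (cR * delta / (G%:R * (G%:R - 1)))%:E
         * \sum_(i in Gs) \sum_(l in Gs) \int[P]_w (sqn (Msg k i w - Msg k l w))%:E)%E) ->
  0 < cR ->
  0 < p -> p <= 1 ->
  0 < gamma -> gamma <= 1 / (L + Num.sqrt A) ->
  48 * cR * B * delta < p ->
  forall (K : nat) (kappa : Omega -> nat),
  (* kappa uniform on {0,...,K} and independent of (x^0,...,x^K) *)
  (forall k, (k <= K)%N -> measurable [set w | kappa w = k]) ->
  (forall k (Bt : set ((K.+1).-tuple 'rV[R]_d)), (k <= K)%N -> measurable Bt ->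
     P ([set w | [tuple X (nat_of_ord j) w | j < K.+1] \in Bt] `&` [set w | kappa w = k])
     = (P [set w | [tuple X (nat_of_ord j) w | j < K.+1] \in Bt] * ((K.+1)%:R^-1)%:E)%E) ->
  (\int[P]_w (sqn (grad f (X (kappa w) w)))%:E
   <= (2 / (gamma * (1 - 48 * B * cR * delta / p) * (K.+1)%:R))%:E
        * \int[P]_w (Phi0 w)%:E
      + (24 * cR * delta * zeta ^+ 2 / (p - 48 * B * cR * delta))%:E)%E.
Proof.
move=> G fi f fstar gradfi X Gv Msg A Phi0 G2 delta0 _ _ _ dfij f_smooth f_lb.
move=> B0 zeta0 gf_het Lpm0 gf_var b0 Lcal0 mDhat EDhat VDhat omega0 mQ EQ VQ magg.
move=> sF FS Fg0 Fc Fs FB fresh robust cR0 p_gt0 p1 gamma0 gammaA hB K kappa mkappa.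
move=> kappa_indep.
have df y : differentiable f y by exact: differentiable_glob_f.
have gFE y : grad f y = (G%:R)^-1 *: \sum_(i in Gs) gradfi i y.
  exact: grad_glob_f.
have gF_lip y z : sqn (grad f y - grad f z) <= L ^+ 2 * sqn (y - z).
  exact: sqn_le_enorm.
have mgradfi i : i \in Gs -> measurable_fun setT (gradfi i).
  by move=> iG; apply: (measurable_local_grad G2 gF_lip gf_var iG).
have mgF : measurable_fun setT (grad f) by exact: lipschitz_measurable_rV gF_lip.
have adapted k := iter_adapted gamma x0 mgradfi mDhat mQ magg sF FS Fg0 Fc Fs FB k.
rewrite -/X -/Gv in adapted.
have [mX mG] : (forall k, measurable_fun setT (X k)) /\
    (forall k, measurable_fun setT (Gv k)).
  by split=> k; have /measurable_fun_pairP[] := Fmeas_measurable (sF k) (adapted k).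
have mcoin k : measurable_fun setT (coin k) by exact: Fmeas_measurable (sF _) (Fc k).
have mxi k i : i \in Gs -> measurable_fun setT (xi k i).
  by move=> iG; apply: (Fmeas_measurable (sF k.+1)); have [] := Fs k i iG.
have meta k i : i \in Gs -> measurable_fun setT (eta k i).
  by move=> iG; apply: (Fmeas_measurable (sF k.+1)); have [] := Fs k i iG.
have f_ge y : fstar <= f y by apply: ge_inf => //; exists y.
have p01 : 0 <= p <= 1 by rewrite (ltW p_gt0).
have cd0 : 0 <= cR * delta by rewrite mulr_ge0// ltW.
have hB' : 48 * B * cR * delta < p by rewrite (_ : _ * delta = 48 * cR * B * delta)//; ring.
pose lam := Lcal ^+ 2 / b%:R.
pose V := omega * (L ^+ 2 + Lpm ^+ 2) + (1 + omega) * lam.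
have lam0 : 0 <= lam by rewrite divr_ge0// sqr_ge0.
have V0 : 0 <= V.
  by rewrite addr_ge0// mulr_ge0// addr_ge0// sqr_ge0.
have G0 : (0 : R) < G%:R by rewrite ltr0n; exact: leq_trans G2.
pose good k := [/\ P.-integrable setT (EFin \o (fun w => f (X k w) - fstar)),
  L2 P (fun w => grad f (X k w)) & L2 P (fun w => Gv k w - grad f (X k w))].
have MsgE k i w : i \in Gs -> Msg k i w = if coin k w then gradfi i (X k.+1 w)
    else Gv k w + Q (Dhat i (X k.+1 w) (X k w) (xi k i w)) (eta k i w).
  by move=> iG; rewrite /Msg /msg /worker_msg iG.
(* Adaptedness makes every event about (x^k, g^k) a member of [F k], so freshness relative to the
   filtration specializes to the pair. *)
have round k : good k -> _ := fun h => let: And3 _ Lg Le := h in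
  @round_estimate R d n dO Omega P dS S dQ SQ Gs nu nuQ Dhat Q gradfi (grad f)
    L B zeta Lpm lam omega p gamma G2 gFE gF_lip gf_het gf_var B0 mDhat
    (fun i x y j iG => EDhat i x y j iG) VDhat omega0 mQ EQ VQ p01
    (X k) (Gv k) (coin k) (xi k) (eta k) (mX k) (mG k) (mcoin k) (mxi k) (meta k)
    (fun Aev bb Bs Cs mA => fresh k _ bb Bs Cs (adapted k Aev mA)) Lg Le
    (cR * delta) (X k.+1) (Gv k.+1) (Msg k) cd0 p_gt0 (mG k.+1) (fun=> erefl)
    (MsgE k) (robust k).
have cpos : 0 < 2 / (gamma * (1 - 48 * B * cR * delta / p) * K.+1%:R).
  by rewrite divr_gt0// !mulr_gt0// subr_gt0 ltr_pdivrMr// mul1r.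
have mPhi0 : measurable_fun setT Phi0.
  apply: measurable_funD => //; apply: measurable_funM => //; apply: measurable_sqn.
  by apply: measurable_rVB => //; exact: Fmeas_measurable (sF 0) Fg0.
have Phi00 w : 0 <= Phi0 w.
  rewrite addr_ge0 ?subr_ge0// mulr_ge0 ?sqn_ge0//.
  by rewrite divr_ge0// ltW.
(* If E[Phi_0] is infinite, so is the right-hand side, its coefficient being positive. *)
have [fin|] := ltP (\int[P]_w (Phi0 w)%:E)%E +oo%E; last first.
  by rewrite leye_eq => /eqP ->; rewrite gt0_muley ?lte_fin// addye// leey.
have iPhi0 : P.-integrable setT (EFin \o Phi0).
  apply/integrableP; split; first exact/measurable_EFinP.
  by under eq_integral do rewrite /= ger0_norm//.
have divff_pg : p / gamma * (gamma / p) = 1 by field; rewrite !gt_eqF.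
have good_all k : good k.
  elim: k => [|k ih].
    have i0 : P.-integrable setT (EFin \o (fun=> f x0 - fstar)).
      exact: finite_measure_integrable_cst.
    split; [exact: i0|exact: (L2_cst P (grad f x0))|].
    (* Since f(x^0) >= f_*, the initial squared error is at most (p / gamma) Phi_0. *)
    apply: (@L2_le _ _ _ _ _ _ (fun w => p / gamma * Phi0 w)).
    - by apply: measurable_rVB => //; exact: measurableT_comp.
    - exact: (integrable_EFinZ (p / gamma) iPhi0).
    - move=> w; rewrite /Phi0 mulrDr mulrA divff_pg mul1r lerDr.
      by rewrite mulr_ge0 ?subr_ge0// divr_ge0// ltW.
  have [LN LE _ _] := round k ih; have [fi0 Lg Le] := ih; split => //.
  exact: (descent_integrable gamma0 df f_smooth f_ge (mX k) (mG k) fi0 Lg Le).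
pose Fk k := \int[P]_w (f (X k w) - fstar).
pose N k := Esq P (fun w => grad f (X k w)).
pose E k := Esq P (fun w => Gv k w - grad f (X k w)).
pose D k := Esq P (fun w => X k.+1 w - X k w).
have Fk0 k : 0 <= Fk k by apply: Rintegral_ge0 => w _; rewrite subr_ge0.
have stepD k : 0 <= (gamma^-1 - L - gamma * A) * D k.
  have [L0|L0] := leP 0 L.
    apply: mulr_ge0; last exact: Esq_ge0.
    apply: stepsize_ge0 => //; rewrite /A.
    have q0 : 0 <= 1 - p by rewrite subr_ge0.
    have p0 := ltW p_gt0; have c0 := ltW cR0; have g0' := ltW G0.
    clear -q0 p0 c0 g0' delta0 B0 Lcal0 Lpm0 omega0.
    by repeat first [done | exact: sqr_ge0 | rewrite invr_ge0 | apply: addr_ge0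
      | apply: mulr_ge0].
  (* A negative [L] in the Lipschitz bound forces every norm to vanish, so that all displacements
     are 0. *)
  suff -> : D k = 0 by rewrite mulr0.
  have sq0 (v : 'rV[R]_d) : sqn v = 0.
    have := f_smooth v 0; rewrite subr0 => h.
    have e : enorm v = 0.
      apply/eqP; rewrite eq_le enorm_ge0 andbT -(nmulr_rge0 _ L0).
      exact: le_trans (enorm_ge0 _) h.
    by rewrite -enorm_sqr e expr0n.
  rewrite /D /Esq; under eq_Rintegral do rewrite sq0.
  by rewrite Rintegral_cst//= mul0r.
pose U k := Fk k + gamma / p * E k.
have step k : U k.+1 <= U k
    - gamma / 2 * (1 - 48 * B * cR * delta / p) * N k
    + 12 * gamma * cR * delta * zeta ^+ 2 / p.
  have [_ _ hN hE] := round k (good_all k); have [fi0 Lg Le] := good_all k.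
  have hF := descent_expectation gamma0 df f_smooth f_ge (mX k) (mG k) fi0 Lg Le.
  apply: (@lyapunov_step _ _ _ _ (N k.+1) (D k) _ _ _ _ _ _ _ _ L Lpm lam omega G%:R V A)
    => //; try exact: Esq_ge0.
  by rewrite /A /lam (mulrA (1 + omega) (Lcal ^+ 2) b%:R^-1).
pose C := 12 * gamma * cR * delta * zeta ^+ 2 / p.
have sum_step := telescope_sum step K.+1; rewrite /= -/C in sum_step.
have intPhi0 : (\int[P]_w (Phi0 w)%:E)%E = (U 0)%:E.
  have [i0 _ [_ i1]] := good_all 0%N.
  rewrite /U /Fk /E /Esq -RintegralZl// -RintegralD//; last exact: integrable_EFinZ.
  by rewrite /Rintegral fineK//; exact: integrable_fin_num iPhi0.
pose h k w := sqn (grad f (X k w)).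
have mgX k : measurable_fun setT (fun w => grad f (X k w)).
  exact: measurableT_comp.
have Pkappa k : (k <= K)%N -> P [set w | kappa w = k] = ((K.+1)%:R^-1)%:E.
  move=> kK; have := @kappa_indep k setT kK measurableT.
  have -> : [set w | [tuple X (nat_of_ord j) w | j < K.+1] \in setT] = setT.
    by apply/seteqP; split => // w _ /=; rewrite inE.
  by rewrite setTI probability_setT mul1e.
have kappa_int (k : 'I_K.+1) : (\int[P]_w ((kappa w == k :> nat)%:R * h k w)%:E)%E =
    ((K.+1)%:R^-1 * N k)%:E.
  have kK : (k <= K)%N by rewrite -ltnS.
  have ind : indep_event P (X k) ((fun w => kappa w == k) @^-1` [set true])
      ((K.+1)%:R^-1)%:E.
    move=> Ak mAk.
    (* Independence from the whole trajectory is applied to a cylinder over coordinate k. *)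
    have mB : measurable ((fun t : (K.+1).-tuple 'rV[R]_d => tnth t k) @^-1` Ak).
      by rewrite -[X in measurable X]setTI; exact: measurable_tnth.
    have := @kappa_indep k _ kK mB.
    have -> : [set w | [tuple X (nat_of_ord j) w | j < K.+1] \in
        (fun t : (K.+1).-tuple 'rV[R]_d => tnth t k) @^-1` Ak] = X k @^-1` Ak.
      by apply/seteqP; split => w /=; rewrite inE/= tnth_mktuple.
    have -> : [set w | kappa w = k] = (fun w => kappa w == k) @^-1` [set true].
      by apply/seteqP; split => w /= /eqP.
    by [].
  have K01 : 0 <= (K.+1%:R : R)^-1 <= 1.
    by rewrite invr_ge0 ler0n/= invf_le1// ler1n.
  have mk := measurable_fun_eq_nat (mkappa k kK).
  have mhh : measurable_fun setT (fun v => sqn (grad f v)) by exact: measurable_sqn.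
  rewrite (indep_event_integral (mX k) mk K01 ind mhh)//; last first.
    by move=> v; exact: sqn_ge0.
  by have [_ Lg _] := good_all k; rewrite (L2_Esq Lg).
apply: le_trans (random_index_integral (h := h) mkappa Pkappa _ _) _.
- by move=> k; exact: measurable_sqn.
- by move=> k w; exact: sqn_ge0.
under eq_bigr do rewrite kappa_int.
rewrite sumEFin intPhi0 -EFinM -EFinD lee_fin -mulr_sumr.
have -> : 24 * cR * delta * zeta ^+ 2 = 24 * (cR * delta * zeta ^+ 2) by ring.
apply: telescope_rate => //.
apply: le_trans sum_step _.
have -> : 12 * gamma * (cR * delta * zeta ^+ 2) / p = C by rewrite /C !mulrA.
(* The final Lyapunov value U (K+1) is nonnegative and is dropped. *)
rewrite lerD2r gerBl addr_ge0// mulr_ge0 ?Esq_ge0//.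
by rewrite divr_ge0// ltW.
Qed.
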